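(* Let $k\ge 5$ and let $P$ be a $d$-polytope with $d+k$ vertices, of which at most $d-k+3$ are nonsimple. Then the graph of $P$ determines the entire combinatorial structure of $P$. For the particular case $k=5$, this conclusion is best possible: there is a pair of combinatorially inequivalent $5$-polytopes $Q_5^1$ and $Q_5^2$, each with ten vertices, exactly four of them nonsimple, which have the same graph.
   Context: A $d$-polytope is a convex polytope of dimension $d$. Its graph ($1$-skeleton) has the vertices and edges of the polytope as vertices and edges. A vertex of a $d$-polytope is simple if its degree in the graph is exactly $d$ (equivalently, it lies in exactly $d$ facets), and nonsimple otherwise. The combinatorial structure of a polytope is its lattice of faces ordered by inclusion; two polytopes are combinatorially equivalent if their face lattices are isomorphic. The graph of a $d$-polytope $P$ determines the combinatorial structure of $P$ ($P$ is reconstructible from its graph) if the vertex sets of the facets of $P$ are determined by the graph among all $d$-polytopes, the dimension $d$ being known: whenever $P'$ is a $d$-polytope and $\varphi$ is an isomorphism from the graph of $P$ to the graph of $P'$, the map $\varphi$ is induced by an isomorphism of the face lattices of $P$ and $P'$. *)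

(* Defs.v *)
From mathcomp Require Import all_boot all_order all_algebra.
From mathcomp Require Import classical_sets functions cardinality reals convex.

Set Implicit Arguments.
Unset Strict Implicit.
Unset Printing Implicit Defensive.

Import Order.TTheory GRing.Theory Num.Theory.
Local Open Scope classical_set_scope.
Local Open Scope ring_scope.
Local Open Scope card_scope.

Section Polytopes.
Context {R : realType} {n : nat}.
Implicit Types (A P F : set 'rV[R]_n) (u v : 'rV[R]_n) (d : nat).

Definition conv_hull A : set 'rV[R]_n :=
  smallest (@convex_set R 'rV[R]_n) A.

Definition polytope P := exists2 A, finite_set A & P = conv_hull A.

Definition flat v (U : {vspace 'rV[R]_n}) : set 'rV[R]_n :=
  [set v + u | u in [set` U]].

Definition aff_hull A : set 'rV[R]_n :=
  smallest [set F | exists v U, F = flat v U] A.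

(* The base point is required to lie in [A], so the empty set has no
   dimension in this sense (its dimension is conventionally -1). *)
Definition has_dim A d :=
  exists2 v, A v & exists2 U : {vspace 'rV[R]_n},
    \dim U = d & aff_hull A = flat v U.

Definition d_polytope d P := polytope P /\ has_dim P d.

Definition dot u v : R := \sum_(i < n) u 0 i * v 0 i.

(* [c = 0] yields the two improper faces, [P] (for [b = 0]) and the empty
   face (for [b = 1]). *)
Definition faces P : set (set 'rV[R]_n) :=
  [set F | exists (c : 'rV[R]_n) (b : R),
     (forall x, P x -> dot c x <= b) /\ F = P `&` [set x | dot c x = b]].

Definition vertices P : set 'rV[R]_n := [set v | faces P [set v]].

Definition edges P : set (set 'rV[R]_n) := [set F | faces P F /\ has_dim F 1].

Definition adjacent P u v :=
  [/\ vertices P u, vertices P v, u <> v &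
      exists2 F, edges P F & F u /\ F v].

(* [d] is meant to be the dimension of [P]. *)
Definition simple_vertex d P v :=
  vertices P v /\ [set u | adjacent P v u] #= `I_d.

Definition nonsimple_vertices d P : set 'rV[R]_n :=
  [set v | vertices P v /\ ~ simple_vertex d P v].

End Polytopes.

Section Isomorphisms.
Context {R : realType} {n m : nat}.
Implicit Types (P : set 'rV[R]_n) (Q : set 'rV[R]_m).

(* Only the values of [phi] on the vertices of [P] matter, and only the values
   of [Phi] on the faces of [P]. *)
Definition graph_iso P Q (phi : 'rV[R]_n -> 'rV[R]_m) :=
  set_bij (vertices P) (vertices Q) phi /\
  forall u v, vertices P u -> vertices P v ->
    (adjacent P u v <-> adjacent Q (phi u) (phi v)).

Definition face_lattice_iso P Q (Phi : set 'rV[R]_n -> set 'rV[R]_m) :=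
  set_bij (faces P) (faces Q) Phi /\
  forall F G, faces P F -> faces P G -> (F `<=` G <-> Phi F `<=` Phi G).

Definition same_graph P Q := exists phi, graph_iso P Q phi.

Definition comb_equivalent P Q := exists Phi, face_lattice_iso P Q Phi.

End Isomorphisms.

Definition reconstructible {R : realType} {n : nat} (d : nat)
    (P : set 'rV[R]_n) :=
  forall (m : nat) (Q : set 'rV[R]_m) (phi : 'rV[R]_n -> 'rV[R]_m),
    d_polytope d Q -> graph_iso P Q phi ->
    exists2 Phi, face_lattice_iso P Q Phi &
      forall v, vertices P v -> Phi [set v] = [set phi v].

(* Main.v *)
Require Import Defs.
From mathcomp Require Import all_boot all_order all_algebra.
From mathcomp Require Import lra zify.
From mathcomp Require Import boolp reals.

Set Implicit Arguments.
Unset Strict Implicit.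
Unset Printing Implicit Defensive.

Import Order.TTheory GRing.Theory Num.Theory.
Local Open Scope ring_scope.

(** Index the vertices of a [d]-polytope by a finite type [T] and let [L] be the
    space of restrictions to [T] of the affine functions.  A set of vertices is
    the vertex set of a face exactly when it is the zero set of a nonnegative
    function of [L], so the face lattice, the graph and all the convex geometry
    below are statements about [L].  The record [vertex_space] lists what they
    rest on: [L] is a vector space with the constants, every vertex is exposed,
    and some nonzero function of [L] vanishes at any [d] given vertices, because
    [L] has dimension [d + 1].  Two polytopes with the same graph become two such spaces
    on the same [T] with the same adjacency relation.

    At a simple vertex [x] the functions of [L] vanishing at [x] have a basis
    dual to the neighbours of [x]; it consists of nonnegative functions, whose
    zero sets are the [d] facets at [x], one for each neighbour that it omits.
    Along an edge [x y] of simple vertices the [d - 1] facets through the edge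
    are described from both ends, so the neighbours of [x] other than [y]
    correspond to the neighbours of [y] other than [x]: this is the transport
    along the edge ([facet_transport_ex]).  It records the [2]-faces through the
    edge, and a neighbour of [y] other than [x] that is not a neighbour of [x]
    lies on all the facets at [x] but two ([missed2]).

    The transports determine the face lattice.  At most [d - 2] vertices are
    nonsimple, and a facet stays connected when they are deleted, by the
    argument of Balinski's theorem ([facet_connected]); so a facet can be
    followed from simple vertex to simple vertex.  Every face is an intersection
    of facets through simple vertices, because a maximal face avoiding a given
    vertex has at least [d] vertices and hence a simple one ([face_separation]).

    It remains to see that the graph determines the transport along an edge
    [x y] of simple vertices ([transport_agree]).  The transport fixes the common
    neighbours and maps the private neighbours [A] of [x] to the private
    neighbours [B] of [y].  An edge between [a] in [A] and [b] in [B] with a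
    simple end forces [a] to be sent to [b].  Otherwise [a] and its image are
    adjacent and both nonsimple, or they are not adjacent; in the latter case the
    [2]-face through [a], [x], [y] contains a vertex outside both neighbourhoods,
    and these vertices differ for different [a].  Counting [d + k] vertices, at most
    [d - k + 3] of them nonsimple, shows that the nonsimple vertices in question
    and the vertices available for such [2]-faces number at most three together
    ([unshared_bound]).  Two different transports would disagree on at least two
    elements of [A], and three vertices do not suffice for that.

    For the second half, a [5]-polytope with a facet that is a bipyramid over a
    tetrahedron can be bent along the tetrahedron, so that the facet breaks into
    two simplices.  The graph does not change, but the tetrahedron becomes a
    face; in the example its vertices are exactly the nonsimple ones, and so an
    isomorphism of the face lattices would have to preserve it. *)

(** * Faces as zero sets of nonnegative functions *)

Section FunctionSpaces.
Context {R : realFieldType} {T : finType}.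
Implicit Types (f g h : T -> R) (i j v w z : T) (F G X : {set T}).

Record affine_space (L : (T -> R) -> Prop) : Prop := AffineSpace {
  aff_lin : forall a f g, L f -> L g -> L (fun i => a * f i + g i);
  aff_cst : forall c, L (fun=> c) }.

Definition is_face (L : (T -> R) -> Prop) F :=
  exists2 g, L g & (forall i, 0 <= g i) /\ (forall i, (i \in F) = (g i == 0)).

Section AffineSpaces.
Variable L : (T -> R) -> Prop.
Hypothesis affL : affine_space L.

Lemma aff_ext f g : f =1 g -> L f -> L g.
Proof. by move=> /funext ->. Qed.

Lemma aff_scale a f : L f -> L (fun i => a * f i).
Proof.
move=> Lf; apply: aff_ext (aff_lin affL a Lf (aff_cst affL 0)) => i /=.
by rewrite addr0.
Qed.

Lemma aff_add f g : L f -> L g -> L (fun i => f i + g i).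
Proof.
by move=> Lf Lg; apply: aff_ext (aff_lin affL 1 Lf Lg) => i /=; rewrite mul1r.
Qed.

Lemma aff_opp f : L f -> L (fun i => - f i).
Proof. by move=> /(aff_scale (-1)); apply: aff_ext => i; rewrite mulN1r. Qed.

Lemma aff_sub f g : L f -> L g -> L (fun i => f i - g i).
Proof. by move=> Lf /aff_opp; apply: aff_add. Qed.

Lemma aff_subc f c : L f -> L (fun i => f i - c).
Proof. by move=> Lf; apply: aff_sub => //; apply: aff_cst. Qed.

Lemma aff_sum (I : Type) (r : seq I) (P : pred I) (s : I -> T -> R) :
  (forall k, P k -> L (s k)) -> L (fun z => \sum_(k <- r | P k) s k z).
Proof.
move=> LF; elim: r => [|k r IHr].
  by apply: aff_ext (aff_cst affL 0) => z; rewrite big_nil.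
case Pk: (P k); last by apply: aff_ext IHr => z; rewrite big_cons Pk.
apply: aff_ext (aff_add (LF _ Pk) IHr) => z.
by rewrite big_cons Pk.
Qed.

Lemma is_face_setT : is_face L setT.
Proof.
exists (fun=> 0); first exact: aff_cst.
by split=> i; rewrite ?lexx // inE eqxx.
Qed.

(** A face of a face is a face: a large multiple of the function exposing [G]
    makes [f] positive outside [G]. *)
Lemma is_face_zero_set G f : is_face L G -> L f ->
  (forall i, i \in G -> 0 <= f i) -> is_face L [set i in G | f i == 0].
Proof.
move=> [g Lg [g_ge0 gG]] Lf f_ge0.
have g_gt0 i : i \notin G -> 0 < g i.
  by rewrite gG lt_neqAle eq_sym g_ge0 andbT.
pose t := \sum_(i | i \notin G) (`|f i| + 1) / g i.
exists (fun i => t * g i + f i); first exact: aff_lin.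
have pos i : i \notin G -> 0 < t * g i + f i.
  move=> iG; have le_t : (`|f i| + 1) / g i <= t.
    rewrite /t (bigD1 i) //= lerDl sumr_ge0 // => j /andP[jG _].
    by rewrite divr_ge0 ?g_ge0 // addr_ge0.
  move: le_t; rewrite ler_pdivrMr ?g_gt0 // => le_t.
  rewrite -(ltrD2r (- f i)) add0r addrK (lt_le_trans _ le_t) //.
  by rewrite (le_lt_trans (ler_norm (- f i))) // normrN ltrDl.
have zero i : i \in G -> t * g i + f i = f i.
  by rewrite gG => /eqP->; rewrite mulr0 add0r.
split=> i; rewrite ?inE; case: (boolP (i \in G)) => iG.
- by rewrite zero ?f_ge0.
- exact/ltW/pos.
- by rewrite zero.
- by rewrite [RHS]gt_eqF ?pos.
Qed.

Lemma is_face_setI F G : is_face L F -> is_face L G -> is_face L (F :&: G).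
Proof.
move=> faceF [g Lg [g_ge0 gG]].
have -> : F :&: G = [set i in F | g i == 0] by apply/setP=> i; rewrite !inE gG.
by apply: is_face_zero_set => // i _; apply: g_ge0.
Qed.

Lemma is_face_bigcap (I : finType) (P : pred I) (s : I -> {set T}) :
  (forall k, P k -> is_face L (s k)) -> is_face L (\bigcap_(k | P k) s k).
Proof.
move=> faceF; elim/big_ind: _ => //; first exact: is_face_setT.
exact: is_face_setI.
Qed.

Lemma is_face_argmin G f i0 : is_face L G -> L f -> i0 \in G ->
  exists2 m, m \in G & (forall j, j \in G -> f m <= f j) /\
    is_face L [set j in G | f j == f m].
Proof.
move=> faceG Lf i0G; have [m mG min_m] := Order.TotalTheory.arg_minP f i0G.
exists m => //; split=> //.
have -> : [set j in G | f j == f m] = [set j in G | f j - f m == 0].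
  by apply/setP=> j; rewrite !inE subr_eq0.
apply: is_face_zero_set faceG (aff_subc _ Lf) _ => j jG.
by rewrite subr_ge0 min_m.
Qed.

End AffineSpaces.
End FunctionSpaces.

(** * Improving paths along edges *)

Section VertexSpaces.
Context {R : realFieldType} {T : finType}.
Implicit Types (f g h : T -> R) (a b c i j v w x y z : T) (F G X : {set T}).

(** The case of interest is a [d]-polytope with vertices [T] and graph [e], [L]
    being the affine functions.  The third field says that [L] has dimension
    greater than [d]. *)
Record vertex_space (d : nat) (L : (T -> R) -> Prop) (e : rel T) : Prop :=
VertexSpace {
  vs_aff : affine_space L;
  vs_expose : forall v,
    exists2 h, L h & h v = 0 /\ forall j, j != v -> 0 < h j;
  vs_dim : forall X, (#|X| <= d)%N ->
    exists2 g, L g & (exists z, g z != 0) /\ (forall x, x \in X -> g x = 0);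
  vs_adj : forall i j, e i j <-> i != j /\ is_face L [set i; j] }.

Variables (d : nat) (L : (T -> R) -> Prop) (e : rel T).
Hypothesis VS : vertex_space d L e.

Let affL : affine_space L := vs_aff VS.

Lemma adj_sym : symmetric e.
Proof.
by move=> i j; apply/idP/idP => /(vs_adj VS)[ij ?]; apply/(vs_adj VS);
   rewrite eq_sym setUC.
Qed.

Lemma adj_irr i : e i i = false.
Proof. by apply/negP => /(vs_adj VS)[]; rewrite eqxx. Qed.

Lemma adj_neq i j : e i j -> i != j.
Proof. by move/(vs_adj VS)=> []. Qed.

(** Rotate the hyperplane of [h] around [a] in the direction of [g] until it
    touches [G] again.  On the new face [g] is a multiple of [h], so it
    has the same sign at all vertices other than [a]. *)
Lemma is_face_ratio G a g h : is_face L G -> a \in G -> L g -> g a = 0 ->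
  L h -> h a = 0 -> (forall j, j != a -> 0 < h j) ->
  forall b, b \in G -> b != a ->
  exists rho, exists2 G', is_face L G' &
    [/\ a \in G', (exists2 j, j \in G' & j != a),
        (forall j, (j \in G') = (j \in G) && (g j == rho * h j)) &
        (forall j, j \in G -> j != a -> rho * h j <= g j)].
Proof.
move=> faceG aG Lg ga Lh ha h_gt0 b bG ba.
have [m /andP[mG ma] min_m] :=
  @Order.TotalTheory.arg_minP _ _ _ b (fun j => (j \in G) && (j != a))
    (fun j => g j / h j) (introT andP (conj bG ba)).
pose rho := g m / h m.
have le_rho j : j \in G -> j != a -> rho * h j <= g j.
  by move=> jG ja; rewrite -ler_pdivlMr ?h_gt0 // min_m // jG.
exists rho, [set j in G | g j - rho * h j == 0].
  apply: is_face_zero_set => //.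
    by apply: aff_sub => //; apply: aff_scale.
  move=> j jG; rewrite subr_ge0; have [->|ja] := eqVneq j a.
    by rewrite ga ha mulr0.
  exact: le_rho.
split=> //.
- by rewrite inE aG ga ha mulr0 subrr eqxx.
- exists m => //; rewrite inE mG /rho divfK ?subrr ?eqxx //.
  by rewrite gt_eqF ?h_gt0.
- by move=> j; rewrite inE subr_eq0.
Qed.

(** A minimal face containing [a] and another vertex is an edge: a third vertex
    would allow a rotation that produces a smaller face. *)
Lemma face_has_nbr G a b : is_face L G -> a \in G -> b \in G -> b != a ->
  exists2 w, w \in G & e a w.
Proof.
have [n] := ubnP #|G|; elim: n G b => // n IHn G b; rewrite ltnS => leGn.
move=> faceG aG bG ba.
have [h Lh [ha h_gt0]] := vs_expose VS a.
(* For the neighbour sought, the vertex [m] lowest for [h] is a safe choice: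
   the rotation given by a function exposing [m] loses every other [c]. *)
have [m /andP[mG ma] min_m] :=
  @Order.TotalTheory.arg_minP _ _ _ b (fun j => (j \in G) && (j != a))
    h (introT andP (conj bG ba)).
have [c /andP[cG /norP[ca cm]]|G2] :=
  pickP (fun c => (c \in G) && ~~ ((c == a) || (c == m))); last first.
  exists m => //; apply/(vs_adj VS); rewrite eq_sym ma; split=> //.
  suff <- : G = [set a; m] by [].
  apply/setP=> j; rewrite !inE; apply/idP/idP => [jG|/orP[]/eqP-> //].
  by move: (G2 j); rewrite jG /= => /negbFE.
have [k Lk [km k_gt0]] := vs_expose VS m.
have [rho [G' faceG' [aG' [j jG' ja] G'E le_rho]]] :=
  is_face_ratio faceG aG (aff_subc affL (k a) Lk) (subrr _) Lh ha h_gt0 mG ma.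
have G'sub : G' \subset G by apply/subsetP=> i; rewrite G'E => /andP[].
have ltG' : (#|G'| < n)%N.
  apply: leq_trans leGn; apply: proper_card; apply/properP; split=> //.
  exists c => //; rewrite G'E cG /= gt_eqF //.
  have := le_rho _ mG ma; rewrite km sub0r => rho_m.
  have hc := min_m c; rewrite cG ca in hc; have {}hc := hc isT.
  have ka : 0 < k a by rewrite k_gt0 // eq_sym.
  have hm := h_gt0 _ ma.
  have rho_lt0 : rho < 0 by rewrite -(pmulr_llt0 _ hm); lra.
  have : rho * h c <= rho * h m by rewrite ler_nM2l.
  have := k_gt0 _ cm; lra.
have [w wG' aw] := IHn G' j ltG' faceG' aG' jG' ja.
by exists w => //; apply: (subsetP G'sub).
Qed.

(** The step of the simplex algorithm.  Rotating around [a] gives a face on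
    which every vertex other than [a] improves on [a], and this face contains
    a neighbour of [a]. *)
Lemma face_improve G a g z : is_face L G -> a \in G -> L g -> z \in G ->
  g z < g a -> exists2 w, w \in G & e a w /\ g w < g a.
Proof.
move=> faceG aG Lg zG gza.
have za : z != a by apply: contraTneq gza => ->; rewrite ltxx.
have [h Lh [ha h_gt0]] := vs_expose VS a.
have [rho [G' faceG' [aG' [j jG' ja] G'E le_rho]]] :=
  is_face_ratio faceG aG (aff_subc affL (g a) Lg) (subrr _) Lh ha h_gt0 zG za.
have [w wG' aw] := face_has_nbr faceG' aG' jG' ja.
move: wG'; rewrite G'E => /andP[wG /eqP gw].
exists w => //; split=> //; rewrite -subr_lt0 gw.
have wa : w != a by rewrite eq_sym adj_neq.
have hz := h_gt0 _ za; have hw := h_gt0 _ wa.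
have rho_lt0 : rho < 0.
  by rewrite -(pmulr_llt0 _ hz); apply: le_lt_trans (le_rho _ zG za) _; lra.
by rewrite nmulr_rlt0.
Qed.

(** Within a face the neighbours of a vertex span: this is how the degree of a
    vertex is compared with dimensions. *)
Lemma face_vanish G a g : is_face L G -> a \in G -> L g -> g a = 0 ->
  (forall w, w \in G -> e a w -> g w = 0) -> forall z, z \in G -> g z = 0.
Proof.
move=> faceG aG Lg ga gN z zG; apply/eqP; case: ltgtP => // gz.
  have [|w wG [aw]] := face_improve faceG aG Lg zG; first by rewrite ga.
  by rewrite gN // ga ltxx.
have [|w wG [aw]] := face_improve faceG aG (aff_opp affL Lg) zG.
  by rewrite ga; lra.
by rewrite gN // ga ltxx.
Qed.

Definition induced X : rel T := fun i j => [&& e i j, i \in X & j \in X].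

Lemma induced_sym X : symmetric (induced X).
Proof. by move=> i j; rewrite /induced adj_sym [(i \in X) && _]andbC. Qed.

(** The set [X] is left arbitrary so that it can be a face deprived of some
    vertices, as long as the climb avoids these. *)
Lemma climb G X f i : is_face L G -> L f -> i \in G -> i \in X ->
  (forall j, j \in G -> f i < f j -> j \in X) ->
  exists2 m, m \in G & [/\ forall j, j \in G -> f j <= f m, f i <= f m
    & connect (induced X) i m].
Proof.
move=> faceG Lf; have [n] := ubnP #|[set j in G | f i < f j]|.
elim: n i => // n IHn i; rewrite ltnS => le_n iG iX GX.
have [j /andP[jG ij]|max_i] := pickP (fun j => (j \in G) && (f i < f j)).
  have [|w wG [iw fw]] := face_improve faceG iG (aff_opp affL Lf) jG.
    by rewrite ltrN2.
  have {}fw : f i < f w by rewrite -ltrN2.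
  have wX : w \in X by apply: GX.
  have [||k kG [max_k fwk wk]] := IHn w _ wG wX.
  - apply: leq_trans le_n; apply: proper_card; apply/properP; split.
      by apply/subsetP=> k; rewrite !inE => /andP[-> /(lt_trans fw)->].
    by exists w; rewrite !inE wG ?fw ?ltxx.
  - by move=> k kG fwk; apply: GX => //; apply: lt_trans fwk.
  exists k => //; split=> //; first exact/ltW/(lt_le_trans fw).
  by apply: connect_trans (connect1 _) wk; rewrite /induced iw iX.
exists i => //; split=> // j jG; rewrite leNgt; apply/negP=> ij.
by have := max_i j; rewrite jG ij.
Qed.

(** Climb with respect to a function that exposes the target. *)
Lemma face_connected G i t : is_face L G -> i \in G -> t \in G ->
  connect (induced G) i t.
Proof.
move=> faceG iG tG; have [h Lh [ht h_gt0]] := vs_expose VS t.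
have [//|m mG [max_m _ im]] := climb faceG (aff_opp affL Lh) iG iG.
suff <- : m = t by [].
apply: contraTeq (max_m _ tG) => mt.
by rewrite -ltNge ltrN2 ht h_gt0.
Qed.

End VertexSpaces.

(** * Facets at simple vertices and transport along edges *)

Section SimpleVertices.
Context {R : realFieldType} {T : finType}.
Implicit Types (f g h : T -> R) (a b c i j l v w x y z : T) (F G X : {set T}).

Definition nbr (e : rel T) x : {set T} := [set w | e x w].

(** For a simple [x] this is the facet through [x] and all its neighbours but
    [w], described as the set of vertices in the affine hull of these. *)
Definition facet_at (L : (T -> R) -> Prop) (e : rel T) x w : {set T} :=
  [set z | `[< forall g, L g -> g x = 0 ->
    (forall j, j \in nbr e x -> j != w -> g j = 0) -> g z = 0 >]].

(** For a simple [x] the face spanned by [x] and [z] is determined by the facets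
    at [x] that miss [z]. *)
Definition missed_at (L : (T -> R) -> Prop) (e : rel T) x z : {set T} :=
  [set w in nbr e x | z \notin facet_at L e x w].

(** The neighbour of [c] that is missing from the facet through [x] and [c] that
    misses the neighbour [l] of [x]; the default [l] is never reached when [x]
    and [c] are simple and adjacent and [l] differs from [c]. *)
Definition transport_along (L : (T -> R) -> Prop) (e : rel T) x c l : T :=
  odflt l [pick w in nbr e c | facet_at L e c w == facet_at L e x l].

Variables (d : nat) (L : (T -> R) -> Prop) (e : rel T).
Hypothesis VS : vertex_space d L e.

Let affL : affine_space L := vs_aff VS.

Local Notation N := (nbr e).
Local Notation facet := (facet_at L e).
Local Notation missed := (missed_at L e).
Local Notation transport := (transport_along L e).
Local Notation simple x := (#|nbr e x| = d).

Lemma nbr_vanish x g : L g -> g x = 0 -> (forall j, j \in N x -> g j = 0) ->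
  forall z, g z = 0.
Proof.
move=> Lg gx gN z.
apply: (face_vanish VS (is_face_setT affL) _ Lg gx) => // w _ xw.
by apply: gN; rewrite inE.
Qed.

(** Vanishing at [x] and at [d - 1] of its neighbours is [d] conditions, so some
    nonzero function remains; it cannot vanish at the last neighbour, and after
    scaling it increases along every edge at [x]. *)
Lemma simple_dual x w : simple x -> w \in N x ->
  exists lam, [/\ L lam, lam x = 0, lam w = 1,
    forall j, j \in N x -> j != w -> lam j = 0 & forall z, 0 <= lam z].
Proof.
move=> dx wN; have [|g Lg [[z gz] g0]] := @vs_dim _ _ _ _ _ VS (x |: N x :\ w).
  rewrite -dx (cardsD1 w (N x)) wN (leq_trans (leq_card_setU _ _)) //.
  by rewrite cards1.
have gx : g x = 0 by rewrite g0 // setU11.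
have gN j : j \in N x -> j != w -> g j = 0.
  by move=> jN jw; rewrite g0 // in_setU1 in_setD1 jw jN orbT.
have gw : g w != 0.
  apply: contraNneq gz => gw; apply/eqP/(nbr_vanish Lg gx) => j jN.
  by have [->//|jw] := eqVneq j w; apply: gN.
pose lam z := (g w)^-1 * g z; exists lam.
have Llam : L lam by apply: aff_scale.
have lamN j : j \in N x -> j != w -> lam j = 0.
  by move=> jN jw; rewrite /lam (gN j) // mulr0.
split=> // [||u]; rewrite ?/lam ?gx ?mulr0 ?mulVf // leNgt; apply/negP=> u_lt0.
have [|k _ [xk]] := face_improve VS (is_face_setT affL) (in_setT x) Llam
  (in_setT u); first by rewrite /lam gx mulr0.
rewrite {2}/lam gx mulr0; have [->|kw] := eqVneq k w.
  by rewrite /lam mulVf // ltr10.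
by rewrite lamN ?ltxx // inE.
Qed.

(** The vertex figure of a simple vertex is a simplex, and these are its
    coordinates. *)
Lemma simple_basis x : simple x -> exists lam : T -> T -> R,
  [/\ forall w, w \in N x ->
        [/\ L (lam w), lam w x = 0 & forall z, 0 <= lam w z],
      forall w j, w \in N x -> j \in N x -> lam w j = (j == w)%:R,
      forall w z, w \in N x -> (z \in facet x w) = (lam w z == 0) &
      forall g, L g -> g x = 0 ->
        forall z, g z = \sum_(w in N x) g w * lam w z].
Proof.
move=> dx; have /choice[lam lamP] : forall w, exists lam, w \in N x ->
    [/\ L lam, lam x = 0, lam w = 1,
    forall j, j \in N x -> j != w -> lam j = 0 & forall z, 0 <= lam z].
  move=> w; case: (boolP (w \in N x)) => [wN|_]; last by exists (fun=> 0).
  by have [lam lamP] := simple_dual dx wN; exists lam.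
have lamN w j : w \in N x -> j \in N x -> lam w j = (j == w)%:R.
  move=> wN jN; have [_ _ lamw lam0 _] := lamP w wN.
  by have [->|jw] := eqVneq j w; rewrite ?lamw ?lam0.
have expand g : L g -> g x = 0 ->
    forall z, g z = \sum_(w in N x) g w * lam w z.
  move=> Lg gx z; apply/eqP; rewrite -subr_eq0; apply/eqP.
  pose h z := g z - \sum_(w in N x) g w * lam w z.
  apply: (@nbr_vanish x h); rewrite /h.
  - apply: aff_sub => //; apply: aff_sum => // w wN; apply: aff_scale => //.
    by have [] := lamP w wN.
  - rewrite gx sub0r big1 ?oppr0 // => w wN; have [_ -> _ _ _] := lamP w wN.
    by rewrite mulr0.
  - move=> j jN; rewrite (bigD1 j) //= lamN // eqxx mulr1 big1 ?addr0 ?subrr //.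
    by move=> w /andP[wN wj]; rewrite lamN // eq_sym (negPf wj) mulr0.
exists lam; split=> // [w wN|w z wN]; first by have [] := lamP w wN.
have [Llam lamx lamw lam0 _] := lamP w wN.
rewrite inE; apply/asboolP/eqP => [/(_ (lam w))->//|lamz g Lg gx gN].
rewrite (expand g Lg gx) (bigD1 w) //= lamz mulr0 add0r big1 // => j.
by move=> /andP[jN jw]; rewrite gN // mul0r.
Qed.

Lemma facet_face x w : simple x -> w \in N x -> is_face L (facet x w).
Proof.
move=> /simple_basis[lam [lamP _ facetE _]] wN.
by exists (lam w); have [//] := lamP w wN => _ _ ?; split=> // i; apply: facetE.
Qed.

Lemma facet_root x w : x \in facet x w.
Proof. by rewrite inE; apply/asboolP. Qed.

Lemma facet_nbr x w j : simple x -> w \in N x -> j \in N x ->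
  (j \in facet x w) = (j != w).
Proof.
move=> /simple_basis[lam [_ lamN facetE _]] wN jN.
by rewrite facetE // lamN // pnatr_eq0 eqb0.
Qed.

Lemma facet_inj x : simple x -> {in N x &, injective (facet x)}.
Proof.
move=> dx l w lN wN eq_lw; apply/eqP; rewrite -[_ == _]negbK.
by rewrite -(facet_nbr dx wN lN) -eq_lw facet_nbr // eqxx.
Qed.

Lemma missed_nbr x w : simple x -> w \in N x -> missed x w = [set w].
Proof.
move=> dx wN; apply/setP=> j; rewrite in_set in_set1.
case: (boolP (j \in N x)) => jN; first by rewrite facet_nbr // negbK eq_sym.
by symmetry; apply/negbTE; apply: contraNneq jN => ->.
Qed.

(** A vertex missed by no facet at [x] is [x], and one missed by a single facet
    lies on the ray from [x] through the corresponding neighbour, hence is that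
    neighbour since both are vertices. *)
Lemma missed_gt1 x z : simple x -> z != x -> ~~ e x z -> (1 < #|missed x z|)%N.
Proof.
move=> dx zx xz.
have [lam [lamP lamN facetE expand]] := simple_basis dx.
have lam0 w : w \in N x -> w \notin missed x z -> lam w z = 0.
  by move=> wN; rewrite in_set wN facetE // negbK => /eqP.
rewrite ltnNge; apply/negP; rewrite leq_eqVlt ltnS leqn0 cards_eq0.
have [hz Lhz [hzz hz_gt0]] := vs_expose VS z.
case/orP=> [/cards1P[w misw]|/eqP mis0]; last first.
  have [h Lh [hx h_gt0]] := vs_expose VS x.
  have := h_gt0 z zx; rewrite (expand h Lh hx z) big1 ?ltxx // => w wN.
  by rewrite lam0 ?mulr0 // mis0 inE.
have wN : w \in N x by have := set11 w; rewrite -misw inE => /andP[].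
have {}expand g : L g -> g z - g x = (g w - g x) * lam w z.
  move=> /(aff_subc affL (g x)) Lg; rewrite (expand _ Lg) ?subrr //.
  rewrite (bigD1 w) //= big1 ?addr0 // => j /andP[jN jw].
  by rewrite lam0 ?mulr0 // misw inE.
have zw : z != w by apply: contraNneq xz => ->; rewrite inE in wN.
have [h Lh [hw h_gt0]] := vs_expose VS w.
have wx : w != x by apply: contraTneq wN => ->; rewrite inE (adj_irr VS).
have hz_w : 0 < hz w by rewrite hz_gt0 // eq_sym.
have hz_x : 0 < hz x by rewrite hz_gt0 // eq_sym.
have h_x : 0 < h x by rewrite h_gt0 // eq_sym.
have h_z := h_gt0 _ zw; have [_ _ /(_ z) t_ge0] := lamP w wN.
have t_lt1 : lam w z < 1.
  rewrite -subr_gt0 -(pmulr_rgt0 _ h_x).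
  by have := expand _ Lh; rewrite hw; lra.
have := expand _ Lhz; rewrite hzz => eq_t.
have : 0 <= hz w * lam w z by rewrite mulr_ge0 // ltW.
have : 0 < hz x * (1 - lam w z) by rewrite mulr_gt0 // subr_gt0.
lra.
Qed.

(** The dual function [lam l] at [x] vanishes at [c] but not at all its
    neighbours.  If [w] is a neighbour of [c] off the facet, the dual function of
    [w] at [c] vanishes on the whole facet, so it is a multiple of [lam l]. *)
Lemma facet_transport_ex x c l : simple x -> simple c -> e x c ->
  l \in N x -> l != c -> exists2 w, w \in N c & facet c w = facet x l.
Proof.
move=> dx dc xc lN lc.
have cN : c \in N x by rewrite inE.
have [lam [lamP lamN facetE expand]] := simple_basis dx.
have [mu [muP muN facetcE expandc]] := simple_basis dc.
have [Llam lamx _] := lamP l lN.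
have lamc : lam l c = 0 by rewrite lamN // eq_sym (negPf lc).
have [w /andP[wN lamw]|lam0] := pickP (fun w => (w \in N c) && (lam l w != 0));
    last first.
  have := lamN l l lN lN; rewrite (expandc _ Llam lamc) eqxx big1.
    by move/eqP; rewrite eq_sym oner_eq0.
  move=> w wN; have := lam0 w; rewrite wN /= => /negbFE/eqP->.
  by rewrite mul0r.
have [Lmu muc mu_ge0] := muP w wN.
have mu0 z : z \in facet x l -> mu w z = 0.
  apply: (face_vanish VS (facet_face dx lN) _ Lmu muc).
    by rewrite facetE // lamc.
  move=> u uF cu; have uN : u \in N c by rewrite inE.
  rewrite muN //; have [uw|//] := eqVneq u w.
  by move: uF lamw; rewrite uw facetE // => ->.
have muE z : mu w z = mu w l * lam l z.
  rewrite (expand _ Lmu (mu0 _ (facet_root x l)) z) (bigD1 l) //= big1 ?addr0 //.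
  move=> j /andP[jN jl]; rewrite mu0 ?mul0r //.
  by rewrite facet_nbr.
exists w => //; apply/setP=> z; rewrite facetE // facetcE // muE mulf_eq0.
suff /negPf-> : mu w l != 0 by [].
have := muN w w wN wN; rewrite muE eqxx => /eqP.
by apply: contraTneq => ->; rewrite mul0r eq_sym oner_eq0.
Qed.

Section Transport.
Variables x c : T.
Hypotheses (dx : simple x) (dc : simple c) (xc : e x c).

Lemma transportP l : l \in N x -> l != c ->
  [/\ transport x c l \in N c, transport x c l != x
    & facet c (transport x c l) = facet x l].
Proof.
move=> lN lc; have [w wN wl] := facet_transport_ex dx dc xc lN lc.
rewrite /transport_along; case: pickP => [u /andP[uN /eqP ul]|/(_ w)]; last first.
  by rewrite wN wl eqxx.
have xN : x \in N c by rewrite inE (adj_sym VS).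
split=> //=; apply: contraTneq (facet_root x l) => ux.
by rewrite -ul ux facet_nbr ?eqxx.
Qed.

Lemma transport_uniq l w : l \in N x -> l != c -> w \in N c ->
  facet c w = facet x l -> transport x c l = w.
Proof.
move=> lN lc wN wl; have [tN _ tl] := transportP lN lc.
by apply: (facet_inj dc) => //; rewrite tl.
Qed.

Lemma transport_missing l z : l \in N x -> l != c -> z \in N c ->
  (z \notin facet x l) = (z == transport x c l).
Proof.
move=> lN lc zN; have [tN _ <-] := transportP lN lc.
by rewrite facet_nbr // negbK.
Qed.
End Transport.

Lemma transportK x c l : simple x -> simple c -> e x c ->
  l \in N x -> l != c -> transport c x (transport x c l) = l.
Proof.
move=> dx dc xc lN lc; have [tN tx tl] := transportP dx dc xc lN lc.
have cx : e c x by rewrite (adj_sym VS).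
by apply: transport_uniq.
Qed.

(** Except for the facet that misses [c], the facets at [x] contain [c] and are
    also facets at [c], where the neighbour [z] of [c] is missed by one only. *)
Lemma missed_simple_nbr x c z : simple x -> simple c -> e x c -> e c z ->
  z != x -> missed x z :\ c = [set transport c x z].
Proof.
move=> dx dc xc cz zx; have zN : z \in N c by rewrite inE.
have cx : e c x by rewrite (adj_sym VS).
have [tN tc tz] := transportP dc dx cx zN zx.
apply/setP=> l; rewrite !in_setD1 in_set1 in_set.
apply/andP/eqP => [[lc /andP[lN]]|->].
  by rewrite (transport_missing dx dc xc) // => /eqP->; rewrite transportK.
by rewrite tc tN tz facet_nbr // eqxx.
Qed.

(** The main local tool: a vertex [z] joined to [x] by a simple vertex [c] but not
    by an edge misses two facets at [x] only, and one of these is opposite to [c]. *)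
Lemma missed2 x c z : simple x -> simple c -> e x c -> e c z ->
  z != x -> ~~ e x z -> missed x z = [set c; transport c x z].
Proof.
move=> dx dc xc cz zx xz; have misc := missed_simple_nbr dx dc xc cz zx.
have cm : c \in missed x z.
  have := missed_gt1 dx zx xz; rewrite (cardsD1 c) misc cards1.
  by case: (c \in _).
by rewrite -{1}(setD1K cm) misc.
Qed.

End SimpleVertices.

(** * The neighbourhood of an edge with simple ends *)

Section EdgeNeighbourhoods.
Context {T : finType}.
Implicit Types (e : rel T) (x y z : T).

Definition simple_set d e : {set T} := [set z | #|nbr e z| == d].

Definition common e x y : {set T} := nbr e x :&: nbr e y.

Definition private e x y : {set T} := nbr e x :\: (y |: nbr e y).

(** For adjacent [x] and [y] this excludes [x] and [y] themselves. *)
Definition rest e x y : {set T} := ~: (nbr e x :|: nbr e y).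

(** The vertices of [rest] that can lie on the [2]-faces through the edge [x y]
    and a private neighbour of [x]; see [face_rest_free]. *)
Definition free_rest d e x y : {set T} :=
  [set r in rest e x y |
    [forall c in common e x y :&: simple_set d e, ~~ e c r]].

Definition unshared e x y : {set T} :=
  private e x y :|: private e y x :|: rest e x y.

End EdgeNeighbourhoods.

Section SimpleEdge.
Context {R : realFieldType} {T : finType}.
Implicit Types (f g h : T -> R) (a b c i j l v w x y z r : T).

Variables (d : nat) (L : (T -> R) -> Prop) (e : rel T).
Hypothesis VS : vertex_space d L e.

Let affL : affine_space L := vs_aff VS.

Local Notation N := (nbr e).
Local Notation facet := (facet_at L e).
Local Notation missed := (missed_at L e).
Local Notation transport := (transport_along L e).
Local Notation simple x := (#|nbr e x| = d).

Lemma adjC i j : e i j = e j i. Proof. exact: adj_sym VS i j. Qed.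

Lemma simple_nbr_missed x c z : simple x -> simple c -> e x c -> e c z ->
  z != x -> ~~ e x z -> c \in missed x z.
Proof.
by move=> dx dc xc cz zx xz; rewrite (missed2 VS dx dc xc cz zx xz) set21.
Qed.

Lemma transport_common x y c : simple x -> simple y -> e x y ->
  c \in common e x y -> transport x y c = c.
Proof.
move=> dx dy xy /setIP[cx cy].
have cy' : c != y by rewrite eq_sym (adj_neq VS) // -[e _ _]in_set.
apply/esym/eqP; rewrite -(transport_missing VS dx dy xy) //.
by rewrite (facet_nbr VS) // eqxx.
Qed.

Lemma transport_inj x y : simple x -> simple y -> e x y ->
  {in N x :\ y &, injective (transport x y)}.
Proof.
move=> dx dy xy l l' /setD1P[ly lN] /setD1P[l'y l'N] eq_t.
by rewrite -(transportK VS dx dy xy lN ly) eq_t (transportK VS).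
Qed.

Lemma privateP (e' : rel T) x y z :
  reflect [/\ e' x z, ~~ e' y z & z != y] (z \in private e' x y).
Proof.
rewrite !inE negb_or; apply: (iffP idP) => [/andP[/andP[-> ->] ->]|[-> -> ->]] //.
Qed.

Lemma restP (e' : rel T) x y z : reflect (~~ e' x z /\ ~~ e' y z) (z \in rest e' x y).
Proof. by rewrite !inE negb_or; apply: andP. Qed.

Lemma private_sub x y a : a \in private e x y -> a \in N x /\ a != y.
Proof. by case/privateP => xa _ ay; rewrite inE. Qed.

Section FixedEdge.
Variables x y : T.
Hypotheses (dx : simple x) (dy : simple y) (xy : e x y).

Local Notation tau := (transport x y).

Let yx : e y x. Proof. by rewrite adjC. Qed.

(** The image of a private neighbour is not a common neighbour, since the
    transport is injective and fixes the common neighbours. *)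
Lemma transport_private a : a \in private e x y -> tau a \in private e y x.
Proof.
move=> aA; have [aN ay] := private_sub aA.
have [tN tx _] := transportP VS dx dy xy aN ay.
apply/privateP; split=> //; first by rewrite inE in tN.
apply/negP => xt; have tC : tau a \in common e x y.
  by rewrite inE [tau a \in N x]inE xt tN.
have ta := transport_common dx dy xy tC.
have ty : tau a != y by rewrite eq_sym (adj_neq VS) // -[e _ _]in_set.
have eq_ta : tau a = a.
  have xtN : tau a \in N x by rewrite inE.
  by apply: (transport_inj dx dy xy) => //; rewrite in_setD1 ?ty ?ay.
by case/privateP: aA; rewrite -eq_ta; rewrite inE in tN; rewrite tN.
Qed.

Lemma missed_transport a : a \in private e x y ->
  missed x (tau a) = [set y; a].
Proof.
move=> aA; have [aN ay] := private_sub aA.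
have /privateP[yt xt tx] := transport_private aA.
by rewrite (missed2 VS dx dy xy) // (transportK VS).
Qed.

(** This is the [2]-face through [x], [y] and [a] when [a] differs from [y]: the
    intersection of the other facets at [x]. *)
Lemma is_face_missed a : a \in N x ->
  exists2 G, is_face L G & forall z, (z \in G) = (missed x z \subset [set y; a]).
Proof.
move=> aN; exists (\bigcap_(l | (l \in N x) && (l \notin [set y; a])) facet x l).
  by apply: is_face_bigcap => // l /andP[lN _]; apply: (facet_face VS).
move=> z; apply/bigcapP/subsetP => [zF l|zM l /andP[lN l_ya]].
  rewrite inE => /andP[lN]; apply: contraR => l_ya.
  by apply: zF; rewrite lN.
by apply: contraR l_ya => zl; apply: zM; rewrite inE lN.
Qed.

Lemma missed_eq2 z a : z != x -> ~~ e x z -> missed x z \subset [set y; a] ->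
  missed x z = [set y; a].
Proof.
move=> zx xz sub; apply/eqP; rewrite eqEcard sub.
by apply: leq_trans (missed_gt1 VS dx zx xz); rewrite cards2; case: (_ != _).
Qed.

(** The vertices outside both neighbourhoods on the [2]-face through [a], [x]
    and [y]. *)
Definition face_rest a : {set T} :=
  [set r in rest e x y | missed x r == [set y; a]].

(** In the [2]-face through [a], [x] and [y] the vertex [a] has a neighbour other
    than [x]; not being the image of [a], it is adjacent neither to [x] nor to
    [y]. *)
Lemma face_rest_nbr a : a \in private e x y -> ~~ e a (tau a) ->
  exists2 r, r \in face_rest a & e a r.
Proof.
move=> aA nat; have [aN ay] := private_sub aA.
have /privateP[xa ya _] := aA.
have yN : y \in N x by rewrite inE.
have [lam [lamP lamN facetE _]] := simple_basis VS dx.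
have [G faceG GE] := is_face_missed aN.
have [Llama lamax _] := lamP a aN; have [Llamy lamyx _] := lamP y yN.
(* On the [2]-face, the value of [g] is 0 at [x], -1 at [a] and -2 at [y]: a
   step from [a] that decreases [g] does not lead to [x]. *)
pose g z := - (2 * lam y z + lam a z).
have Lg : L g by apply: aff_opp => //; apply: aff_lin.
have inG w : w \in [set y; a] -> w \in G.
  move=> w_ya; rewrite GE (missed_nbr VS) ?sub1set //.
  by case/set2P: w_ya => ->.
have [|w wG [aw gw]] := face_improve VS faceG (inG a (set22 _ _)) Lg
  (inG y (set21 _ _)).
  have yaF : (y == a) = false by rewrite eq_sym (negPf ay).
  by rewrite /g !lamN // !eqxx yaF (negPf ay) /=; lra.
have wx : w != x.
  apply: contraTneq gw => ->; rewrite /g lamax lamyx !lamN // eqxx (negPf ay) /=.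
  by rewrite -leNgt; lra.
have nxw : ~~ e x w.
  apply/negP => xw; have wN : w \in N x by rewrite inE.
  move: wG; rewrite GE (missed_nbr VS) // sub1set => /set2P[] eq_w.
    by move: ya; rewrite -eq_w adjC aw.
  by move: aw; rewrite eq_w (adj_irr VS).
have misw : missed x w = [set y; a] by apply: missed_eq2 => //; rewrite -GE.
exists w => //; rewrite inE misw eqxx andbT; apply/restP; split=> //.
apply/negP => yw; have yN' : w \in N y by rewrite inE.
have := missed2 VS dx dy xy yw wx nxw; rewrite misw => /setP/(_ a).
rewrite set22 => /esym/set2P[/eqP|aw']; first by rewrite (negPf ay).
by move: nat; rewrite aw' (transportK VS) // -aw' aw.
Qed.

End FixedEdge.

Lemma face_rest_sub x y a : simple x -> simple y -> e x y ->
  a \in private e x y -> face_rest x y a \subset face_rest y x (transport x y a).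
Proof.
move=> dx dy xy aA; have [aN ay] := private_sub aA.
apply/subsetP=> r; rewrite !inE => /andP[/norP[nxr nyr] /eqP mis].
rewrite !(negPf nxr) !(negPf nyr) /=; apply/eqP/missed_eq2 => //.
- by apply: contraNneq nxr => ->.
apply/subsetP=> w; rewrite inE => /andP[wN rw].
have yx : e y x by rewrite adjC.
have [->|wx] := eqVneq w x; first exact: set21.
have [tN ty tw] := transportP VS dy dx yx wN wx.
have : transport y x w \in missed x r by rewrite inE tN tw.
rewrite mis => /set2P[/eqP|<-]; first by rewrite (negPf ty).
by rewrite (transportK VS) // set22.
Qed.

(** The [2]-face is the same seen from [y]. *)
Lemma face_restC x y a : simple x -> simple y -> e x y ->
  a \in private e x y -> face_rest x y a = face_rest y x (transport x y a).
Proof.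
move=> dx dy xy aA; have [aN ay] := private_sub aA.
apply/eqP; rewrite eqEsubset face_rest_sub //=.
have yx : e y x by rewrite adjC.
have tA := transport_private dx dy xy aA.
by have := face_rest_sub dy dx yx tA; rewrite (transportK VS).
Qed.

Lemma face_rest_nbr_transport x y a : simple x -> simple y -> e x y ->
  a \in private e x y -> ~~ e a (transport x y a) ->
  exists2 r, r \in face_rest x y a & e (transport x y a) r.
Proof.
move=> dx dy xy aA nat; have [aN ay] := private_sub aA.
have yx : e y x by rewrite adjC.
have tA := transport_private dx dy xy aA.
have := face_rest_nbr dy dx yx tA; rewrite (transportK VS) // adjC => /(_ nat).
by rewrite -face_restC.
Qed.

(** By [missed2] for the neighbour [y] of [x], the vertex [b] misses the facets
    at [x] opposite to [y] and to its preimage; for the simple neighbour [a] of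
    [b], one of these two facets is the one opposite to [a]. *)
Lemma transport_adj_l x y a b : simple x -> simple y -> e x y ->
  a \in private e x y -> b \in private e y x -> e a b -> simple a ->
  transport x y a = b.
Proof.
move=> dx dy xy aA /privateP[yb nxb bx] ab da; have [aN ay] := private_sub aA.
have xa : e x a by rewrite inE in aN.
have yx : e y x by rewrite adjC.
have bN : b \in N y by rewrite inE.
have := simple_nbr_missed dx da xa ab bx nxb.
rewrite (missed2 VS dx dy xy yb bx nxb) => /set2P[/eqP|->].
  by rewrite (negPf ay).
by rewrite (transportK VS).
Qed.

Lemma transport_adj x y a b : simple x -> simple y -> e x y ->
  a \in private e x y -> b \in private e y x -> e a b ->
  simple a \/ simple b -> transport x y a = b.
Proof.
move=> dx dy xy aA bB ab [da|db]; first exact: transport_adj_l.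
have yx : e y x by rewrite adjC.
have [bN bx] := private_sub bB.
rewrite -(transport_adj_l dy dx yx bB aA _ db) 1?adjC //.
by rewrite (transportK VS).
Qed.

(** The vertex [r] misses only the facets at [x] opposite to [y] and to [a'], and
    the one opposite to its neighbour [a] is among them. *)
Lemma simple_face_rest x y a a' r : simple x -> simple y -> e x y ->
  a \in private e x y -> simple a -> e a r -> r \in face_rest x y a' -> a = a'.
Proof.
move=> dx dy xy /privateP[xa nya ay] da ar; rewrite inE.
move=> /andP[/restP[nxr nyr] /eqP mis].
have rx : r != x by apply: contraNneq nyr => ->; rewrite adjC.
have := simple_nbr_missed dx da xa ar rx nxr.
by rewrite mis => /set2P[/eqP|//]; rewrite (negPf ay).
Qed.

Lemma face_rest_disjoint x y a a' r : a != y -> r \in face_rest x y a ->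
  r \in face_rest x y a' -> a = a'.
Proof.
move=> ay; rewrite inE => /andP[_ /eqP mis].
rewrite inE mis => /andP[_ /eqP/setP/(_ a)].
by rewrite set22 => /esym/set2P[/eqP|//]; rewrite (negPf ay).
Qed.

(** A simple common neighbour [c] adjacent to a vertex of the [2]-face would be
    one of its two neighbours of [x], by [simple_nbr_missed]. *)
Lemma face_rest_free x y a : simple x -> simple y -> e x y ->
  a \in private e x y -> face_rest x y a \subset free_rest d e x y.
Proof.
move=> dx dy xy /privateP[xa nya ay]; apply/subsetP => r.
rewrite inE => /andP[rR /eqP mis]; have /restP[nxr nyr] := rR.
have rx : r != x by apply: contraNneq nyr => ->; rewrite adjC.
rewrite inE rR; apply/forall_inP => c.
rewrite !inE => /andP[/andP[xc yc] /eqP dc]; apply/negP => cr.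
have := simple_nbr_missed dx dc xc cr rx nxr.
rewrite mis => /set2P[] eq_c; first by rewrite eq_c (adj_irr VS) in yc.
by rewrite -eq_c yc in nya.
Qed.

(** Each simple common neighbour [c] takes vertices away from [free_rest]: the
    transport along [x c] sends every private neighbour [a] of [x] to a vertex of
    [rest] adjacent to [c], and [a] and [c] are recovered from the facets at [x]
    that miss this vertex. *)
Lemma card_bound_rest x y : simple x -> simple y -> e x y ->
  (#|private e x y| * #|common e x y :&: simple_set d e|
     + #|free_rest d e x y| <= #|rest e x y|)%N.
Proof.
move=> dx dy xy; have yx : e y x by rewrite adjC.
set A := private e x y; set S := _ :&: _.
pose phi (p : T * T) := transport x p.2 p.1.
have phiP a c : a \in A -> c \in S ->
    [/\ e c (phi (a, c)), phi (a, c) \in rest e x y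
      & missed x (phi (a, c)) = [set c; a]].
  move=> aA cS; have [aN ay] := private_sub aA; have /privateP[xa nya _] := aA.
  move: cS; rewrite !inE => /andP[/andP[xc yc] /eqP dc].
  have nca : ~~ e c a.
    apply/negP=> ca; have := simple_nbr_missed dy dc yc ca ay nya.
    have tB := transport_private dx dy xy aA.
    have := missed_transport dy dx yx tB; rewrite (transportK VS) // => ->.
    case/set2P=> eq_c; first by rewrite eq_c (adj_irr VS) in xc.
    by case/privateP: tB; rewrite -eq_c xc.
  have ac : a != c by apply: contraNneq nya => ->.
  have [tN tx tF] := transportP VS dx dc xc aN ac.
  rewrite inE in tN; rewrite /phi /=.
  have nxt : ~~ e x (transport x c a).
    apply/negP => xt.
    have tC : transport x c a \in common e x c by rewrite !inE xt tN.
    have tc : transport x c a != c by rewrite eq_sym (adj_neq VS).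
    have tt := transport_common dx dc xc tC.
    suff eq_t : transport x c a = a by rewrite eq_t (negPf nca) in tN.
    apply: (transport_inj dx dc xc) => //; rewrite in_setD1 ?ac ?tc //=.
    by rewrite inE.
  have mis : missed x (transport x c a) = [set c; a].
    by rewrite (missed2 VS dx dc xc) // (transportK VS).
  split=> //; rewrite negb_or nxt /=; apply/negP => yt.
  have := simple_nbr_missed dx dy xy yt tx nxt.
  rewrite mis => /set2P[] eq_y; last by rewrite eq_y eqxx in ay.
  by rewrite eq_y (adj_irr VS) in yc.
have inj_phi : {in setX A S &, injective phi}.
  move=> [a c] [a' c'] /setXP[aA cS] /setXP[a'A c'S] eq_phi.
  have [_ _ mis] := phiP a c aA cS; have [_ _ mis'] := phiP a' c' a'A c'S.
  have AS a1 c1 : a1 \in A -> c1 \in S -> a1 != c1.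
    case/privateP=> _ nya _; rewrite !inE => /andP[/andP[_ yc1] _].
    by apply: contraNneq nya => ->.
  have eq2 : [set c; a] = [set c'; a'] by rewrite -mis -mis' eq_phi.
  have /set2P[eq_ac|->] : a \in [set c'; a'] by rewrite -eq2 set22.
    by have := AS a c' aA c'S; rewrite eq_ac eqxx.
  have /set2P[->//|eq_ca] : c \in [set c'; a'] by rewrite -eq2 set21.
  by have := AS a' c a'A cS; rewrite eq_ca eqxx.
rewrite -cardsX -(card_in_imset inj_phi).
rewrite -cardsUI (_ : _ :&: _ = set0) ?cards0 ?addn0; last first.
  apply/setP => r; rewrite in_setI in_set0; apply/negbTE/negP => /andP[].
  case/imsetP=> -[a c] /setXP[aA cS] ->; have [ct _ _] := phiP a c aA cS.
  by rewrite inE => /andP[_ /forall_inP/(_ c cS)]; rewrite ct.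
apply: subset_leq_card; apply/subsetP => r.
rewrite in_setU => /orP[/imsetP[[a c] /setXP[aA cS] ->]|].
  by have [] := phiP a c aA cS.
by rewrite inE => /andP[].
Qed.

Lemma card_private x y : simple x -> simple y -> e x y ->
  (#|private e x y| + #|common e x y|).+1 = d.
Proof.
move=> dx dy xy; have yN : y \in N x by rewrite inE.
rewrite -dx (cardsD1 y (N x)) yN add1n; congr _.+1.
rewrite -(cardsID (N y) (N x :\ y)) addnC; congr (_ + _)%N; apply: eq_card => z.
  rewrite !inE; case: eqVneq => //= ->.
  by rewrite (adj_irr VS) andbF.
by rewrite !inE negb_or; case: (z == y); case: (e x z); case: (e y z).
Qed.

Lemma card_rest x y : simple x -> simple y -> e x y ->
  (#|rest e x y| + d + #|private e x y|).+1 = #|T|.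
Proof.
move=> dx dy xy; have yx : e y x by rewrite adjC.
have := cardsUI (N x) (N y); have := card_private dx dy xy.
rewrite -(cardsC (N x :|: N y)) -/(rest e x y) dx dy -/(common e x y).
lia.
Qed.

End SimpleEdge.

(** * The graph determines the transports *)

Lemma uniq_size_le_card (T : finType) (s : seq T) (A : {set T}) :
  uniq s -> all (mem A) s -> (size s <= #|A|)%N.
Proof.
move=> us /allP sA; rewrite -(card_uniqP us); apply: subset_leq_card.
by apply/subsetP.
Qed.

Section TransportDetermined.
Context {R1 R2 : realFieldType} {T : finType}.
Implicit Types (a b c i j l v w x y z r : T).

Variables (d k : nat) (e : rel T).
Hypothesis cardT : #|T| = (d + k)%N.
Hypothesis card_nonsimple : (#|~: simple_set d e| + k <= d + 3)%N.

Local Notation N := (nbr e).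
Local Notation S := (simple_set d e).
Local Notation simple x := (#|nbr e x| = d).

(** Write [m] for the number of private neighbours on either side and [cs] for the
    number of simple common neighbours.  There are [k - 1 - m] vertices in [rest],
    at least [m * cs] of them adjacent to a simple common neighbour, and
    [d - 1 - m - cs] common neighbours are nonsimple; what remains is arithmetic. *)
Lemma unshared_bound (R : realFieldType) (L : (T -> R) -> Prop) x y a :
  vertex_space d L e -> simple x -> simple y -> e x y ->
  a \in private e x y ->
  (#|unshared e x y :\: S| + #|free_rest d e x y| <= 3)%N.
Proof.
move=> VS dx dy xy aA.
have A_gt0 : (0 < #|private e x y|)%N by apply/card_gt0P; exists a.
have := card_bound_rest VS dx dy xy; have := card_private VS dx dy xy.
have := card_rest VS dx dy xy; have := cardsID S (common e x y).
have : (#|unshared e x y :\: S| + #|common e x y :\: S| <= #|~: S|)%N.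
  rewrite -cardsUI (_ : _ :&: (common e x y :\: S) = set0) ?cards0 ?addn0.
    apply: subset_leq_card; apply/subsetP => z; rewrite !in_setU !in_setD in_setC.
    by case: (z \in S).
  apply/setP => z; rewrite !in_setI !in_setD in_set0 !in_setU !inE.
  by case: (e x z); case: (e y z); rewrite ?andbF ?orbT //= !andbF.
set cs := #|_ :&: _|; set m := #|private _ _ _| in A_gt0 *.
move: card_nonsimple; rewrite cardT.
have : (cs <= m * cs)%N by rewrite leq_pmull.
lia.
Qed.

Section Mismatch.
Variables (Ra Rb : realFieldType) (La : (T -> Ra) -> Prop)
  (Lb : (T -> Rb) -> Prop).
Hypotheses (VSa : vertex_space d La e) (VSb : vertex_space d Lb e).
Variables x y : T.
Hypotheses (dx : simple x) (dy : simple y) (xy : e x y).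

Local Notation A := (private e x y).
Local Notation U := (unshared e x y :\: S).
Local Notation F := (free_rest d e x y).
Local Notation ta := (transport_along La e x y).
Local Notation tb := (transport_along Lb e x y).

Lemma mismatch_unshared a : a \in A -> a \notin U -> simple a.
Proof.
move=> aA; rewrite in_setD /unshared !in_setU aA /= andbT negbK inE.
by move/eqP.
Qed.

Lemma mismatch_unshared' b : b \in private e y x -> b \notin U -> simple b.
Proof.
move=> bB; rewrite in_setD /unshared !in_setU bB orbT /= andbT negbK inE.
by move/eqP.
Qed.

(** An edge from [a] to its image with a simple end would force the same image
    for the other polytope. *)
Lemma mismatch_light a : a \in A -> ta a != tb a ->
  ~~ e a (ta a) \/ (a \in U /\ ta a \in U).
Proof.
move=> aA ne_t; have bB := transport_private VSa dx dy xy aA.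
have [eat|] := boolP (e a (ta a)); last by left.
right; split; apply: contraNT ne_t => nU; apply/eqP/esym.
  apply: (transport_adj VSb dx dy xy aA bB eat); left.
  exact: mismatch_unshared nU.
apply: (transport_adj VSb dx dy xy aA bB eat); right.
exact: mismatch_unshared' nU.
Qed.

(** Both transports are bijections between the private neighbours, so they cannot
    disagree at a single one: the preimage under one of them of the image of [a]
    under the other is a second disagreement. *)
Lemma mismatch_partner a : a \in A -> ta a != tb a ->
  exists2 a', a' \in A & (a' != a) && (ta a' != tb a').
Proof.
move=> aA ne_t; have yx : e y x by rewrite (adj_sym VSa).
have bB := transport_private VSb dx dy xy aA.
have [bN bx] := private_sub bB; have [aN ay] := private_sub aA.
have a'A := transport_private VSa dy dx yx bB.
have ta' := transportK VSa dy dx yx bN bx.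
exists (transport_along La e y x (tb a)) => //; rewrite ta'.
have a'a : transport_along La e y x (tb a) != a.
  by apply: contraNneq ne_t => eq_a; rewrite -{1}eq_a ta'.
rewrite a'a /=; apply: contraNneq a'a => eq_b.
have [a'N a'y] := private_sub a'A.
by apply/eqP/(transport_inj VSb dx dy xy); rewrite ?in_setD1 ?a'N ?a'y ?ay.
Qed.

Lemma face_rest_ex a : a \in A -> ~~ e a (ta a) ->
  exists2 r, r \in face_rest La e x y a & r \in F.
Proof.
move=> aA nea; have [r ra _] := face_rest_nbr VSa dx dy xy aA nea.
by exists r => //; apply: (subsetP (face_rest_free VSa dx dy xy aA)).
Qed.

Lemma private_neq a b : a \in A -> b \in private e y x -> a != b.
Proof.
move=> /privateP[xa _ _] /privateP[_ nxb _].
by apply: contraNneq nxb => <-.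
Qed.

(** If [a] and its image are simple, [simple_face_rest] at [x] shows that the
    [2]-face of the other polytope containing [r] is the one through [a], and at
    [y] that it is the one through the image of [a]; but there these are two
    different faces. *)
Lemma face_rest_crossing a c r : a \in A -> c \in A -> ta a != tb a ->
  e a r -> e (ta a) r -> r \in face_rest Lb e x y c ->
  (a \in U) || (ta a \in U).
Proof.
move=> aA cA ne_t ar tr rc; rewrite -[_ || _]negbK negb_or.
apply/negP => /andP[/(mismatch_unshared aA) da].
have tB := transport_private VSa dx dy xy aA.
move/(mismatch_unshared' tB) => dt.
have eq_c := simple_face_rest VSb dx dy xy aA da ar rc.
move: rc; rewrite -eq_c (face_restC VSb) // => rc.
have yx : e y x by rewrite (adj_sym VSa).
have := simple_face_rest VSb dy dx yx tB dt tr rc.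
by move/eqP; rewrite (negPf ne_t).
Qed.

(** When the [2]-face is a pentagon, its fifth vertex is adjacent to both [a] and
    its image. *)
Lemma face_rest_single a r : a \in A -> ~~ e a (ta a) ->
  face_rest La e x y a = [set r] -> e a r /\ e (ta a) r.
Proof.
move=> aA nea Fr; split.
  by have [s] := face_rest_nbr VSa dx dy xy aA nea; rewrite Fr inE => /eqP->.
by have [s] := face_rest_nbr_transport VSa dx dy xy aA nea; rewrite Fr inE => /eqP->.
Qed.

Lemma card_face_rest2 a a' : a \in A -> a' \in A -> a' != a ->
  #|face_rest La e x y a :|: face_rest La e x y a'|
    = (#|face_rest La e x y a| + #|face_rest La e x y a'|)%N.
Proof.
move=> aA a'A a'a; rewrite -cardsUI (_ : _ :&: face_rest La e x y a' = set0).
  by rewrite cards0 addn0.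
apply/setP => r; rewrite in_setI in_set0; apply/negbTE/negP => /andP[ra ra'].
have [_ ay] := private_sub aA.
by move: a'a; rewrite (face_rest_disjoint ay ra ra') eqxx.
Qed.

End Mismatch.

Section NoMismatch.
Variables (Ra Rb : realFieldType) (La : (T -> Ra) -> Prop)
  (Lb : (T -> Rb) -> Prop).
Hypotheses (VSa : vertex_space d La e) (VSb : vertex_space d Lb e).
Variables x y : T.
Hypotheses (dx : simple x) (dy : simple y) (xy : e x y).

Local Notation A := (private e x y).
Local Notation U := (unshared e x y :\: S).
Local Notation F := (free_rest d e x y).
Local Notation ta := (transport_along La e x y).
Local Notation tb := (transport_along Lb e x y).

(** If [a] and its image are adjacent, they are both nonsimple, so at most one
    further vertex is available.  A second disagreement [a'] uses it up in a
    [2]-face, because a second nonsimple pair would be too much.  Then in the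
    other polytope one of [a] and [a'] again belongs to a nonsimple pair, which
    can only be the pair of [a] and its first image. *)
Lemma mismatch_nonadjacent a : a \in A -> ta a != tb a -> ~~ e a (ta a).
Proof.
move=> aA ne_t; have bnd := unshared_bound VSa dx dy xy aA.
have tB := transport_private VSa dx dy xy aA.
have [//|[aU tU]] := mismatch_light VSa VSb dx dy xy aA ne_t.
have [a' a'A /andP[a'a ne_t']] := mismatch_partner VSa VSb dx dy xy aA ne_t.
have tB' := transport_private VSa dx dy xy a'A.
have a'ta := private_neq a'A tB; have ata := private_neq aA tB.
have ata' := private_neq aA tB'; have a'ta' := private_neq a'A tB'.
have U2 : (2 <= #|U|)%N.
  apply: (@uniq_size_le_card _ [:: a; ta a]) => /=; first by rewrite inE ata.
  by rewrite aU tU.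
exfalso.
have [nea'|[a'U t'U]] := mismatch_light VSa VSb dx dy xy a'A ne_t'; last first.
  have tt : ta a != ta a'.
    apply: contraNneq a'a => eq_t; apply/eqP.
    have [aN ay] := private_sub aA; have [a'N a'y] := private_sub a'A.
    by apply: (transport_inj VSa dx dy xy); rewrite ?in_setD1 ?a'N ?a'y ?ay.
  suff U4 : (4 <= #|U|)%N.
    by have := leq_trans U4 (leq_trans (leq_addr _ _) bnd).
  apply: (@uniq_size_le_card _ [:: a'; a; ta a; ta a']) => /=.
    by rewrite !inE !negb_or a'a a'ta a'ta' ata ata' tt.
  by rewrite aU tU a'U t'U.
have [r ra' rF] := face_rest_ex VSa dx dy xy a'A nea'.
have F1 : (0 < #|F|)%N by apply/card_gt0P; exists r.
have UE u : u \in U -> u = a \/ u = ta a.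
  move=> uU; have [->|ua] := eqVneq u a; first by left.
  have [->|ut] := eqVneq u (ta a); first by right.
  suff U3 : (3 <= #|U|)%N by have := leq_trans (leq_add U3 F1) bnd.
  apply: (@uniq_size_le_card _ [:: a; ta a; u]) => /=.
    by rewrite !inE negb_or ata (eq_sym a) ua (eq_sym (ta a)) ut.
  by rewrite aU tU uU.
have F_le1 : (#|F| <= 1)%N.
  by rewrite -(leq_add2l 2); apply: leq_trans bnd; rewrite leq_add2r.
have ne_t2 : tb a != ta a by rewrite eq_sym.
have ne_t2' : tb a' != ta a' by rewrite eq_sym.
have [nea|[_ taU]] := mismatch_light VSb VSa dx dy xy aA ne_t2.
  have [nea2|[a'U _]] := mismatch_light VSb VSa dx dy xy a'A ne_t2'.
    have [s sa sF] := face_rest_ex VSb dx dy xy aA nea.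
    have [s' sa' s'F] := face_rest_ex VSb dx dy xy a'A nea2.
    move/card_le1_eqP: F_le1 => /(_ s s' sF s'F) eq_s.
    move: sa'; rewrite eq_s => sa'; have [_ ay] := private_sub aA.
    by move: a'a; rewrite (face_rest_disjoint ay sa sa') eqxx.
  by case: (UE _ a'U) => [/eqP|/eqP]; rewrite ?(negPf a'a) ?(negPf a'ta).
have bB := transport_private VSb dx dy xy aA.
case: (UE _ taU) => eq_t; last by rewrite eq_t eqxx in ne_t.
by have := private_neq aA bB; rewrite eq_t eqxx.
Qed.

End NoMismatch.

Section Agreement.
Variables (Ra Rb : realFieldType) (La : (T -> Ra) -> Prop)
  (Lb : (T -> Rb) -> Prop).
Hypotheses (VSa : vertex_space d La e) (VSb : vertex_space d Lb e).
Variables x y : T.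
Hypotheses (dx : simple x) (dy : simple y) (xy : e x y).

Local Notation A := (private e x y).
Local Notation U := (unshared e x y :\: S).
Local Notation F := (free_rest d e x y).
Local Notation ta := (transport_along La e x y).
Local Notation tb := (transport_along Lb e x y).
Local Notation Fa := (face_rest La e x y).
Local Notation Fb := (face_rest Lb e x y).

Lemma mismatch_single a c r : a \in A -> c \in A -> ta a != tb a ->
  #|Fa a| = 1%N -> r \in Fa a -> r \in Fb c -> (a \in U) || (ta a \in U).
Proof.
move=> aA cA ne_t /eqP/cards1P[s Fs]; rewrite Fs inE => /eqP-> sc.
have nea := mismatch_nonadjacent VSa VSb dx dy xy aA ne_t.
have [as_ ts] := face_rest_single VSa dx dy xy aA nea Fs.
exact: (face_rest_crossing VSa VSb dx dy xy aA cA ne_t as_ ts sc).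
Qed.

Lemma card_mismatch_face_rest a : a \in A -> ta a != tb a -> (0 < #|Fa a|)%N.
Proof.
move=> aA ne_t; have nea := mismatch_nonadjacent VSa VSb dx dy xy aA ne_t.
have [r ra _] := face_rest_nbr VSa dx dy xy aA nea.
by apply/card_gt0P; exists r.
Qed.

End Agreement.

(** The transports could only disagree at two private neighbours [a] and [a'],
    neither adjacent to its image for either polytope, which gives two disjoint
    nonempty sets of vertices on [2]-faces for each polytope. *)
Theorem transport_agree (L1 : (T -> R1) -> Prop) (L2 : (T -> R2) -> Prop) x y a :
  vertex_space d L1 e -> vertex_space d L2 e ->
  simple x -> simple y -> e x y -> a \in N x -> a != y ->
  transport_along L1 e x y a = transport_along L2 e x y a.
Proof.
move=> VS1 VS2 dx dy xy aN ay.
have [aC|aC] := boolP (a \in common e x y).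
  by rewrite (transport_common VS1) // (transport_common VS2).
have aA : a \in private e x y.
  apply/privateP; split=> //; first by rewrite inE in aN.
  by apply: contra aC => ya; rewrite in_setI aN inE.
apply/eqP; apply: contraT => ne.
have [a' a'A /andP[a'a ne']] := mismatch_partner VS1 VS2 dx dy xy aA ne.
have ne2 : transport_along L2 e x y a != transport_along L1 e x y a.
  by rewrite eq_sym.
have ne2' : transport_along L2 e x y a' != transport_along L1 e x y a'.
  by rewrite eq_sym.
have bnd := unshared_bound VS1 dx dy xy aA.
set U := unshared e x y :\: S in bnd; set F := free_rest d e x y in bnd.
set F1 := face_rest L1 e x y; set F2 := face_rest L2 e x y.
have card1 := card_face_rest2 L1 aA a'A a'a.
have card2 := card_face_rest2 L2 aA a'A a'a.
have sub1 c : c \in private e x y -> F1 c \subset F.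
  exact: (face_rest_free VS1 dx dy xy).
have sub2 c : c \in private e x y -> F2 c \subset F.
  exact: (face_rest_free VS2 dx dy xy).
have gt1 := card_mismatch_face_rest VS1 VS2 dx dy xy aA ne.
have gt1' := card_mismatch_face_rest VS1 VS2 dx dy xy a'A ne'.
have gt2 := card_mismatch_face_rest VS2 VS1 dx dy xy aA ne2.
have gt2' := card_mismatch_face_rest VS2 VS1 dx dy xy a'A ne2'.
have single1 c c' r (cA : c \in _) (c'A : c' \in _) ne_c :=
  @mismatch_single _ _ _ _ VS1 VS2 x y dx dy xy c c' r cA c'A ne_c.
have single2 c c' r (cA : c \in _) (c'A : c' \in _) ne_c :=
  @mismatch_single _ _ _ _ VS2 VS1 x y dx dy xy c c' r cA c'A ne_c.
have subU1 : F1 a :|: F1 a' \subset F by rewrite subUset !sub1.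
have subU2 : F2 a :|: F2 a' \subset F by rewrite subUset !sub2.
have le1 := subset_leq_card subU1; have le2 := subset_leq_card subU2.
rewrite card1 -/F1 in le1; rewrite card2 -/F2 in le2.
rewrite -/F1 -/F2 in gt1 gt1' gt2 gt2' card1 card2.
(* If all the vertices concerned are simple, the vertex of a pentagon lies on
   no [2]-face of the other polytope.  One of the two [2]-faces at [a] and [a']
   is a pentagon, for lack of vertices; this makes both [2]-faces of the other
   polytope pentagons, and four different vertices are needed. *)
have [U0|/set0Pn[u uU]] := eqVneq U set0.
  have F3 : (#|F| <= 3)%N by apply: leq_trans bnd; apply: leq_addl.
  have noU z : z \in U = false by rewrite U0 inE.
  have disj12 c c' : c \in private e x y -> c' \in private e x y ->
      transport_along L1 e x y c != transport_along L2 e x y c ->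
      #|F1 c| = 1%N -> F1 c :&: F2 c' = set0.
    move=> cA c'A ne_c Fc1; apply/setP => r; rewrite in_setI in_set0.
    apply/negbTE/negP => /andP[rc rc'].
    by have := single1 c c' r cA c'A ne_c Fc1 rc rc'; rewrite -/U !noU.
  have disj21 c c' : c \in private e x y -> c' \in private e x y ->
      transport_along L2 e x y c != transport_along L1 e x y c ->
      #|F2 c| = 1%N -> F2 c :&: F1 c' = set0.
    move=> cA c'A ne_c Fc1; apply/setP => r; rewrite in_setI in_set0.
    apply/negbTE/negP => /andP[rc rc'].
    by have := single2 c c' r cA c'A ne_c Fc1 rc rc'; rewrite -/U !noU.
  have lt1 : (#|F1 a| + #|F1 a'| < #|F|)%N.
    rewrite -card1; apply: proper_card; apply/properP; split=> //.
    have [c cA [ne_c Fc1]] : exists2 c, c \in private e x y &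
        transport_along L2 e x y c != transport_along L1 e x y c /\
        #|F2 c| = 1%N.
      have [Fa1|Fa1] := eqVneq #|F2 a| 1%N; first by exists a.
      exists a' => //; split=> //.
      by clear - le2 gt2 gt2' F3 Fa1; move: #|_| #|_| #|_| le2 gt2 gt2' F3 Fa1; lia.
    have /card_gt0P[r rc] : (0 < #|F2 c|)%N by rewrite Fc1.
    exists r; first exact: (subsetP (sub2 c cA)).
    rewrite in_setU negb_or; apply/andP; split; apply/negP => rF.
      by have := disj21 c a cA aA ne_c Fc1 => /setP/(_ r); rewrite in_setI rc rF inE.
    by have := disj21 c a' cA a'A ne_c Fc1 => /setP/(_ r); rewrite in_setI rc rF inE.
  have [Fa1 Fa1'] : #|F1 a| = 1%N /\ #|F1 a'| = 1%N.
    by clear - lt1 gt1 gt1' F3; move: #|_| #|_| #|_| lt1 gt1 gt1' F3; lia.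
  have : (#|(F1 a :|: F1 a') :|: (F2 a :|: F2 a')| <= #|F|)%N.
    by apply: subset_leq_card; rewrite subUset subU1.
  have dis : (F1 a :|: F1 a') :&: (F2 a :|: F2 a') = set0.
    by rewrite setIUl !setIUr !disj12 // !setU0.
  rewrite -[leqLHS]addn0 -(cards0 T) -dis cardsUI card1 card2 Fa1 Fa1'.
  by clear - gt2 gt2' F3; move: #|_| #|_| #|_| gt2 gt2' F3; lia.
have U1 : (1 <= #|U|)%N by apply/card_gt0P; exists u.
have F_le2 : (#|F| <= 2)%N.
  by clear - bnd U1; move: #|_| #|_| bnd U1; lia.
have [Fa2 Fa2'] : #|F2 a| = 1%N /\ #|F2 a'| = 1%N.
  by clear - le2 gt2 gt2' F_le2; move: #|_| #|_| #|_| le2 gt2 gt2' F_le2; lia.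
(* With a nonsimple vertex around, the four [2]-faces are pentagons and those
   of either polytope use all the vertices available; then two nonsimple
   vertices are needed. *)
have F1E : F1 a :|: F1 a' = F.
  apply/eqP; rewrite eqEcard subU1 card1 (leq_trans F_le2) //.
  exact: leq_add gt1 gt1'.
have inU c : c \in private e x y ->
    transport_along L2 e x y c != transport_along L1 e x y c ->
    #|F2 c| = 1%N -> (c \in U) || (transport_along L2 e x y c \in U).
  move=> cA ne_c Fc1; have /card_gt0P[r rc] : (0 < #|F2 c|)%N by rewrite Fc1.
  have : r \in F by apply: (subsetP (sub2 c cA)).
  rewrite -F1E => /setUP[] rF.
    exact: (single2 c a r).
  exact: (single2 c a' r).
have bB := transport_private VS2 dx dy xy aA.
have b'B := transport_private VS2 dx dy xy a'A.
have [v vU vE] : exists2 v, v \in U & v = a \/ v = transport_along L2 e x y a.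
  by case/orP: (inU a aA ne2 Fa2) => vU; eexists; try exact: vU; [left|right].
have [w wU wE] : exists2 w, w \in U &
    w = a' \/ w = transport_along L2 e x y a'.
  by case/orP: (inU a' a'A ne2' Fa2') => wU; eexists; try exact: wU;
     [left|right].
have vw : v != w.
  case: vE => ->; case: wE => ->; first by rewrite eq_sym.
  - exact: private_neq b'B.
  - by rewrite eq_sym; apply: private_neq bB.
  apply: contraNneq a'a => eq_t; apply/eqP.
  have [a'N a'y] := private_sub a'A.
  by apply: (transport_inj VS2 dx dy xy); rewrite ?in_setD1 ?a'N ?a'y ?aN ?ay.
have U2 : (2 <= #|U|)%N.
  apply: (@uniq_size_le_card _ [:: v; w]) => /=; first by rewrite inE vw.
  by rewrite vU wU.
by have := leq_trans (leq_add U2 (leq_trans (leq_add gt1 gt1') le1)) bnd.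
Qed.

End TransportDetermined.

(** * The transports determine the faces *)

Section FacetConnectivity.
Context {R : realFieldType} {T : finType}.
Implicit Types (f g h : T -> R) (i j l t u v w x y z : T) (F G H M : {set T}).

Variables (d : nat) (L : (T -> R) -> Prop) (e : rel T).
Hypothesis VS : vertex_space d L e.

Let affL : affine_space L := vs_aff VS.

Local Notation N := (nbr e).
Local Notation facet := (facet_at L e).
Local Notation simple x := (#|nbr e x| = d).

(** From a vertex where [g] is nonnegative one climbs to the face where [g] is
    maximal, which is connected, and meets no vertex of [M] on the way since [g]
    becomes positive at once. *)
Lemma connected_upper_part G M g z : is_face L G -> L g ->
  (forall m, m \in M -> g m <= 0) -> z \in G -> 0 < g z ->
  exists2 t, t \in G :\: M & forall i, i \in G :\: M -> 0 <= g i ->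
    connect (induced e (G :\: M)) i t.
Proof.
move=> faceG Lg gM zG gz.
have [t tG' max_t'] := Order.TotalTheory.arg_maxP g zG.
have tG : t \in G by exact: tG'.
have max_t j : j \in G -> g j <= g t by apply: max_t'.
have gt_M j : 0 < g j -> j \notin M.
  by apply: contraTN => /gM; rewrite leNgt.
have gt_t : 0 < g t by apply: lt_le_trans gz (max_t z zG).
exists t; first by rewrite in_setD gt_M.
move=> i /[dup] iGM /setDP[iG _] gi.
have [|m mG [max_m _ im]] := climb VS faceG Lg iG iGM.
  by move=> j jG ij; rewrite in_setD jG gt_M // (le_lt_trans gi).
apply: connect_trans im _.
have gm : g m = g t by apply/eqP; rewrite eq_le max_t //= max_m.
have faceX : is_face L [set j in G | g t - g j == 0].
  apply: is_face_zero_set => //.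
    by apply: aff_sub => //; apply: aff_cst.
  by move=> j jG; rewrite subr_ge0; apply: max_t.
have mX : m \in [set j in G | g t - g j == 0] by rewrite inE mG gm subrr eqxx.
have tX : t \in [set j in G | g t - g j == 0] by rewrite inE tG subrr eqxx.
apply: connect_sub (face_connected VS faceX mX tX) => i' j'.
rewrite /induced => /and3P[ij].
rewrite !inE !subr_eq0 => /andP[iG' /eqP gi'] /andP[jG' /eqP gj'].
by apply: connect1; rewrite /induced ij !in_setD iG' jG' !gt_M -?gi' -?gj'.
Qed.

(** The argument of Balinski's theorem: take a function vanishing on [M] and at
    [v0]; if it is positive somewhere on the facet, the vertices where it is
    nonnegative are connected to each other, and likewise with the opposite sign;
    [v0] belongs to both parts. *)
Lemma facet_connected x l M v0 v1 : simple x -> l \in N x ->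
  (#|M| + 2 <= d)%N -> v0 \in facet x l :\: M -> v1 \in facet x l :\: M ->
  connect (induced e (facet x l :\: M)) v0 v1.
Proof.
move=> dx lN cardM v0F v1F; set F := facet x l in v0F v1F *.
have faceF : is_face L F by apply: (facet_face VS).
(* The condition at [l], off the facet, makes sure that [g] does not vanish on
   the whole facet. *)
have [|g Lg [[z gz] g0]] := @vs_dim _ _ _ _ _ VS (v0 |: (l |: M)).
  rewrite (leq_trans _ cardM) // addn2 (leq_trans (leq_card_setU _ _)) //.
  rewrite cards1 add1n ltnS (leq_trans (leq_card_setU _ _)) //.
  by rewrite cards1 add1n.
have gM m : m \in M -> g m = 0 by move=> mM; rewrite g0 // !in_setU mM !orbT.
have gv0 : g v0 = 0 by rewrite g0 // setU11.
have symX : connect_sym (induced e (F :\: M)).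
  exact: sym_connect_sym (induced_sym VS _).
have [u uF gu] : exists2 u, u \in F & g u != 0.
  have [u /andP[uF gu]|gF] := pickP (fun u => (u \in F) && (g u != 0)).
    by exists u.
  have {}gF u : u \in F -> g u = 0.
    by move=> uF; have := gF u; rewrite uF /= => /negbFE/eqP.
  case/eqP: gz; apply: (nbr_vanish VS Lg (gF x _)); first exact: facet_root.
  move=> j jN; have [->|jl] := eqVneq j l; first by rewrite g0 // !inE eqxx orbT.
  by apply: gF; rewrite (facet_nbr VS).
have up := connected_upper_part faceF Lg (M := M).
have down := connected_upper_part faceF (aff_opp affL Lg) (M := M).
have [p /andP[pF gp]|le0] := pickP (fun p => (p \in F) && (0 < g p)).
  have [|t _ tP] := up p _ pF gp; first by move=> m /gM->.
  have v0t := tP v0 v0F; rewrite gv0 in v0t.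
  have [q /andP[qF gq]|ge0] := pickP (fun q => (q \in F) && (g q < 0)).
    have [||t' _ t'P] := down q _ qF; first by move=> m /gM->; rewrite oppr0.
      by rewrite oppr_gt0.
    have v0t' := t'P v0 v0F; rewrite gv0 oppr0 in v0t'.
    have [gv1|/ltW gv1] := leP 0 (g v1).
      by apply: connect_trans (v0t (lexx _)) _; rewrite symX tP.
    by apply: connect_trans (v0t' (lexx _)) _; rewrite symX t'P // oppr_ge0.
  apply: connect_trans (v0t (lexx _)) _; rewrite symX tP // leNgt.
  by have := ge0 v1; case/setDP: v1F => -> _ /= ->.
have gu0 : g u < 0.
  have := le0 u; rewrite uF /= => /negbT; rewrite -leNgt => gu_le0.
  by rewrite lt_neqAle gu.
have [||t _ tP] := down u _ uF; first by move=> m /gM->; rewrite oppr0.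
  by rewrite oppr_gt0.
have v0t := tP v0 v0F; rewrite gv0 oppr0 in v0t.
apply: connect_trans (v0t (lexx _)) _; rewrite symX tP // oppr_ge0 leNgt.
by have := le0 v1; case/setDP: v1F => -> _ /= ->.
Qed.

(** Take a maximal face that contains [G] and avoids [z].  A nonzero function
    vanishing on it and at [z] could be used to tilt its hyperplane until another
    vertex is reached, still avoiding [z]; so there is none, and the face has at
    least [d] vertices.  One of them is simple, and at a simple vertex a face is
    an intersection of facets. *)
Lemma face_separation G z : (#|~: simple_set d e| < d)%N ->
  is_face L G -> z \notin G ->
  exists x, exists2 w, simple x /\ w \in N x &
    G \subset facet x w /\ z \notin facet x w.
Proof.
move=> card_ns faceG zG.
pose P H := [&& `[< is_face L H >], G \subset H & z \notin H].
have PG : P G by rewrite /P zG subxx; apply/and3P; split=> //; apply/asboolP.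
have [H /and3P[/asboolP faceH GH zH] max_H] := arg_maxnP (fun H => #|H|) PG.
have [gam Lgam [gam_ge0 gamH]] := faceH.
have gam_gt0 u : u \notin H -> 0 < gam u.
  by rewrite gamH lt_neqAle eq_sym gam_ge0 andbT.
have rigid g u : L g -> (forall v, v \in z |: H -> g v = 0) -> ~ g u < 0.
  move=> Lg gH gu.
  have [m gm min_m] :=
    @Order.TotalTheory.arg_minP _ _ _ u (fun j => g j < 0)
      (fun j => gam j / - g j) gu.
  have gmH : m \notin H by apply: contraTN gm => mH; rewrite gH ?ltxx ?setU1r.
  (* The largest [t] for which [t * g + gam] is nonnegative. *)
  pose t := gam m / - g m.
  have t_gt0 : 0 < t by rewrite divr_gt0 ?gam_gt0 // oppr_gt0.
  pose f j := t * g j + gam j.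
  have Lf : L f by apply: aff_lin.
  have f_ge0 j : 0 <= f j.
    have [gj|gj] := ltP (g j) 0; last first.
      by rewrite addr_ge0 // mulr_ge0 // ltW.
    have := min_m j gj; rewrite -/t ler_pdivlMr ?oppr_gt0 // /f; lra.
  have faceH' : is_face L [set j | f j == 0].
    by exists f => //; split=> // j; rewrite inE.
  have zH' : z \notin [set j | f j == 0].
    by rewrite inE /f gH ?setU11 // mulr0 add0r gt_eqF ?gam_gt0.
  have HH' : H \subset [set j | f j == 0].
    apply/subsetP => j jH; rewrite inE /f gH ?setU1r // mulr0 add0r.
    by rewrite -gamH.
  have mH' : m \in [set j | f j == 0].
    rewrite inE /f /t invrN mulrN mulNr divfK ?addNr //.
    by rewrite lt_eqF.
  have : (#|[set j | f j == 0%R]| <= #|H|)%N.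
    apply: max_H.
    by apply/and3P; split=> //; [apply/asboolP|apply: subset_trans HH'].
  rewrite leqNgt => /negP[]; apply: proper_card; apply/properP; split=> //.
  by exists m.
have dH : (d <= #|H|)%N.
  rewrite leqNgt; apply/negP => Hd.
  have [|g Lg [[u gu] gH]] := @vs_dim _ _ _ _ _ VS (z |: H).
    by rewrite cardsU1 zH.
  have g_ge0 : 0 <= g u by rewrite leNgt; apply/negP/(rigid g u Lg gH).
  have g_le0 : 0 <= - g u.
    rewrite leNgt; apply/negP/(rigid _ u (aff_opp affL Lg)) => v vH.
    by rewrite gH ?oppr0.
  by case/eqP: gu; lra.
have [x /andP[xH xS]|noS] := pickP (fun x => (x \in H) && (x \in simple_set d e));
    last first.
  have : (d <= #|~: simple_set d e|)%N.
    apply: leq_trans dH _; apply: subset_leq_card; apply/subsetP => x xH.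
    by rewrite in_setC; have := noS x; rewrite xH /= => ->.
  by rewrite leqNgt card_ns.
have dx : simple x by move: xS; rewrite inE => /eqP.
have [lam [lamP lamN facetE expand]] := simple_basis VS dx.
have gamx : gam x = 0 by apply/eqP; rewrite -gamH.
have [w /and3P[wN gw lw]|no_w] :=
    pickP (fun w => [&& w \in N x, gam w != 0 & lam w z != 0]); last first.
  have := gam_gt0 z zH; rewrite (expand _ Lgam gamx z) big1 ?ltxx // => w wN.
  have := no_w w; rewrite wN /= => /negbT; rewrite negb_and !negbK.
  by case/orP => /eqP->; rewrite ?mul0r ?mulr0.
exists x, w => //; split; last by rewrite facetE.
apply: subset_trans GH _; apply/subsetP => u; rewrite gamH => /eqP gu.
have := expand _ Lgam gamx u; rewrite gu => /esym/psumr_eq0P sum0.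
rewrite facetE //; have := sum0 _ w wN => /(_ _)/eqP.
rewrite mulf_eq0 (negPf gw) /= => -> // i iN.
by have [_ _ lam_ge0] := lamP i iN; rewrite mulr_ge0.
Qed.

End FacetConnectivity.

Section FacesDetermined.
Context {T : finType}.
Implicit Types (i j l t u v w x y z : T) (F G H M : {set T}).

Variables (d k : nat) (e : rel T).
Hypothesis cardT : #|T| = (d + k)%N.
Hypothesis card_nonsimple : (#|~: simple_set d e| + k <= d + 3)%N.
Hypothesis k_ge5 : (5 <= k)%N.

Local Notation N := (nbr e).
Local Notation S := (simple_set d e).
Local Notation simple x := (#|nbr e x| = d).

Variables (Ra Rb : realFieldType) (La : (T -> Ra) -> Prop)
  (Lb : (T -> Rb) -> Prop).
Hypotheses (VSa : vertex_space d La e) (VSb : vertex_space d Lb e).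

Let card_ns2 : (#|~: S| + 2 <= d)%N.
Proof. by move: card_nonsimple k_ge5; lia. Qed.

(** Both polytopes carry the facet along the path in the same way, because their
    transports agree. *)
Lemma facet_along_path F p x l : simple x -> l \in N x ->
  facet_at La e x l = F -> path (induced e (F :\: ~: S)) x p ->
  exists l', [/\ l' \in N (last x p), facet_at La e (last x p) l' = F
    & facet_at Lb e (last x p) l' = facet_at Lb e x l].
Proof.
elim: p x l => [|z p IHp] x l dx lN xlF /=; first by exists l.
case/andP=> /and3P[xz _ /setDP[zF]]; rewrite in_setC negbK inE => /eqP dz zp.
have zN : z \in N x by rewrite inE.
have lz : l != z by move: zF; rewrite -xlF (facet_nbr VSa) // eq_sym.
have [tN _ tF] := transportP VSa dx dz xz lN lz.
have [_ _ tFb] := transportP VSb dx dz xz lN lz.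
rewrite -(transport_agree cardT card_nonsimple VSa VSb dx dz xz lN lz) in tFb.
by rewrite -tFb; apply: IHp => //; rewrite tF.
Qed.

(** The simple vertices of the facet are joined to [x] inside it.  A nonsimple one
    is joined to [x] after the other nonsimple vertices are deleted, so that it
    has a simple neighbour in the facet. *)
Lemma facet_sub x l : simple x -> l \in N x ->
  facet_at La e x l \subset facet_at Lb e x l.
Proof.
move=> dx lN; set F := facet_at La e x l.
have xF : x \in F by apply: facet_root.
have xS : x \in S by rewrite inE dx.
have inF z : z \in F -> z \in S ->
    exists l', [/\ l' \in N z, facet_at La e z l' = F
      & facet_at Lb e z l' = facet_at Lb e x l].
  move=> zF zS; have /connectP[p xp ->] : connect (induced e (F :\: ~: S)) x z.
    by apply: (facet_connected VSa); rewrite // in_setD in_setC negbK ?xS ?zS.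
  exact: facet_along_path xp.
apply/subsetP => z zF; have [zS|zS] := boolP (z \in S).
  by have [l' [_ _ <-]] := inF z zF zS; apply: facet_root.
have : connect (induced e (F :\: (~: S :\ z))) z x.
  apply: (facet_connected VSa) => //.
  - apply: leq_trans card_ns2; rewrite leq_add2r subset_leq_card //.
    exact: subD1set.
  - by rewrite in_setD zF in_setD1 eqxx.
  - by rewrite in_setD xF in_setD1 in_setC xS andbF.
case/connectP=> -[|u p] /=; first by move=> _ eq_x; rewrite -eq_x xS in zS.
case/andP=> /and3P[zu _ /setDP[uF]]; rewrite in_setD1 in_setC negb_and !negbK.
have uz : u != z by rewrite eq_sym (adj_neq VSa).
rewrite (negPf uz) /= => uS _ _.
have [l' [l'N l'F <-]] := inF u uF uS.
have zN : z \in N u by rewrite inE (adj_sym VSa).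
have du : simple u by move: uS; rewrite inE => /eqP.
rewrite (facet_nbr VSb) //; move: zF; rewrite -l'F (facet_nbr VSa) //.
Qed.

End FacesDetermined.

Theorem faces_determined (T : finType) (d k : nat) (e : rel T)
    (Ra Rb : realFieldType) (La : (T -> Ra) -> Prop) (Lb : (T -> Rb) -> Prop)
    (G : {set T}) :
  #|T| = (d + k)%N -> (#|~: simple_set d e| + k <= d + 3)%N -> (5 <= k)%N ->
  vertex_space d La e -> vertex_space d Lb e -> is_face La G -> is_face Lb G.
Proof.
move=> cardT card_ns k5 VSa VSb faceG.
have facetE x l : #|nbr e x| = d -> l \in nbr e x ->
    facet_at La e x l = facet_at Lb e x l.
  move=> dx lN; apply/eqP.
  by rewrite eqEsubset !(facet_sub cardT card_ns k5 _ _ dx lN).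
have /choice[H HP] : forall z, exists H, z \notin G ->
    [/\ is_face Lb H, G \subset H & z \notin H].
  move=> z; have [zG|zG] := boolP (z \in G); first by exists set0.
  have [|x [w [dx wN] [GF zF]]] := face_separation VSa _ faceG zG.
    by move: card_ns k5; lia.
  exists (facet_at Lb e x w) => _; rewrite -facetE //; split=> //.
  by rewrite facetE //; apply: (facet_face VSb).
have -> : G = \bigcap_(z | z \notin G) H z.
  apply/eqP; rewrite eqEsubset; apply/andP; split.
    by apply/bigcapsP => z /HP[].
  apply/subsetP => u /bigcapP uH; apply: contraT => uG.
  by have [_ _] := HP u uG; rewrite uH.
by apply: (is_face_bigcap (vs_aff VSb)) => z /HP[].
Qed.

From mathcomp Require Import classical_sets functions cardinality convex.

Local Open Scope classical_set_scope.
Local Open Scope ring_scope.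
Local Open Scope card_scope.

(** * Linear and convex preliminaries *)

Section Dot.
Context {R : realType} {n : nat}.
Implicit Types (u v w c : 'rV[R]_n) (t b : R).

Lemma dotDl u v w : dot (u + v) w = dot u w + dot v w.
Proof.
by rewrite /dot -big_split; apply: eq_bigr => i _; rewrite mxE mulrDl.
Qed.

Lemma dotZl t u w : dot (t *: u) w = t * dot u w.
Proof.
by rewrite /dot mulr_sumr; apply: eq_bigr => i _; rewrite mxE mulrA.
Qed.

Lemma dotC u w : dot u w = dot w u.
Proof. by apply: eq_bigr => i _; rewrite mulrC. Qed.

Lemma dotDr u v w : dot u (v + w) = dot u v + dot u w.
Proof. by rewrite dotC dotDl !(dotC _ u). Qed.

Lemma dotZr t u w : dot u (t *: w) = t * dot u w.
Proof. by rewrite dotC dotZl dotC. Qed.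

Lemma dotNl u w : dot (- u) w = - dot u w.
Proof. by rewrite -scaleN1r dotZl mulN1r. Qed.

Lemma dotNr u w : dot u (- w) = - dot u w.
Proof. by rewrite dotC dotNl dotC. Qed.

Lemma dotBr u v w : dot u (v - w) = dot u v - dot u w.
Proof. by rewrite dotDr dotNr. Qed.

Lemma dot0l u : dot 0 u = 0.
Proof. by rewrite -(scale0r 0) dotZl mul0r. Qed.

Lemma dot_self_eq0 u : dot u u = 0 -> u = 0.
Proof.
move=> /eqP; rewrite /dot psumr_eq0 => [/allP u0|i _]; last first.
  by rewrite -expr2 sqr_ge0.
apply/rowP => i; rewrite mxE; apply/eqP.
by have := u0 i (mem_index_enum _); rewrite mulf_eq0 orbb.
Qed.

(** A coordinate of the projection along [U] that does not vanish at [w]. *)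
Lemma dot_separates (U : {vspace 'rV[R]_n}) w : w \notin U ->
  exists2 c, (forall u, u \in U -> dot c u = 0) & dot c w != 0.
Proof.
move=> wU; pose p u := u - projv U u.
have pw : p w != 0.
  by apply: contraNneq wU => /eqP; rewrite subr_eq0 => /eqP->; apply: memv_proj.
have [k pwk] : exists k, p w 0 k != 0.
  apply/existsP; apply: contraNT pw; rewrite negb_exists => /forallP pw0.
  by apply/eqP/rowP => k; rewrite [RHS]mxE; apply/eqP; rewrite -[_ == _]negbK.
have pE u : dot (\row_i p (delta_mx 0 i) 0 k) u = p u 0 k.
  rewrite {2}(row_sum_delta u) /p linear_sum /= -sumrB summxE.
  by apply: eq_bigr => i _; rewrite linearZ -scalerBr !mxE mulrC.
exists (\row_i p (delta_mx 0 i) 0 k); last by rewrite pE.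
by move=> u uU; rewrite pE /p projv_id // subrr mxE.
Qed.

End Dot.

Section Convexity.
Context {R : realType} {n : nat}.
Implicit Types (A E F G P : set 'rV[R]_n) (u v w x y c : 'rV[R]_n) (t b : R).

Lemma convex_setP A :
  (forall x y t, 0 < t -> t < 1 -> A x -> A y -> A (t *: x + (1 - t) *: y)) ->
  @convex_set R 'rV[R]_n A.
Proof.
move=> cA; apply/convex_setW => x y /set_mem Ax /set_mem Ay k k0 k1.
by apply/mem_set; exact: cA.
Qed.

Lemma conv_hull_sub A E :
  (forall x y t, 0 < t -> t < 1 -> E x -> E y -> E (t *: x + (1 - t) *: y)) ->
  A `<=` E -> conv_hull A `<=` E.
Proof. by move=> cE AE; apply: smallest_sub => //; apply: convex_setP. Qed.

Lemma sub_conv_hull A : A `<=` conv_hull A.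
Proof. exact: sub_gen_smallest. Qed.

(** A function bounded by [b] on [A] is bounded by [b] on the hull, and equality
    at a convex combination forces equality at the points combined; the set
    defined by the conclusion is therefore convex. *)
Lemma conv_hull_le_eq A c b E :
  (forall x y t, 0 < t -> t < 1 -> E x -> E y -> E (t *: x + (1 - t) *: y)) ->
  (forall x, A x -> dot c x <= b /\ (dot c x = b -> E x)) ->
  forall x, conv_hull A x -> dot c x <= b /\ (dot c x = b -> E x).
Proof.
move=> cE AE; apply: conv_hull_sub => // x y t t0 t1 [xb xE] [yb yE].
rewrite dotDr !dotZr; have xt : t * dot c x <= t * b by rewrite ler_pM2l.
have yt : (1 - t) * dot c y <= (1 - t) * b by rewrite ler_pM2l // subr_gt0.
split=> [|eqb]; first by lra.
have {}xt : t * dot c x = t * b by lra.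
have {}yt : (1 - t) * dot c y = (1 - t) * b by lra.
apply: cE => //; [apply: xE|apply: yE].
  by apply: (mulfI (lt0r_neq0 t0)).
by apply: (mulfI _ yt); rewrite subr_eq0 gt_eqF.
Qed.

Definition affine_values {T : finType} (pos : T -> 'rV[R]_n) : (T -> R) -> Prop :=
  fun f => exists c b, forall i, f i = dot c (pos i) + b.

Lemma affine_values_space {T : finType} (pos : T -> 'rV[R]_n) :
  affine_space (affine_values pos).
Proof.
split=> [a f g [c [b fE]] [c' [b' gE]]|b].
  exists (a *: c + c'), (a * b + b') => i.
  by rewrite fE gE dotDl dotZl mulrDr; lra.
by exists 0, b => i; rewrite dot0l add0r.
Qed.

(** A minimal nonempty face among those where first [c0] and then [c] is maximal
    consists of one point, since the difference of two of its points would be a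
    function that is not constant on it. *)
Lemma exposed_vertex {T : finType} (pos : T -> 'rV[R]_n) c0 b0 c i :
  (forall j, dot c0 (pos j) <= b0) -> dot c0 (pos i) = b0 ->
  exists2 v, vertices (conv_hull (range pos)) v &
    dot c0 v = b0 /\ dot c (pos i) <= dot c v.
Proof.
move=> le_b0 eq_b0; have aff := affine_values_space pos.
have affc c' : affine_values pos (fun j => dot c' (pos j)).
  by exists c', 0 => j; rewrite addr0.
have face0 : is_face (affine_values pos) [set j | b0 - dot c0 (pos j) == 0]%SET.
  exists (fun j => b0 - dot c0 (pos j)).
    by exists (- c0), b0 => j; rewrite dotNl addrC.
  by split=> j; rewrite ?inE // subr_ge0.
have i0 : i \in [set j | b0 - dot c0 (pos j) == 0]%SET.
  by rewrite inE eq_b0 subrr.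
have [m0 m0G [min0 face1]] := is_face_argmin aff face0 (affc (- c)) i0.
set G1 := finset _ in face1.
pose P (G : {set T}) := [&& `[< is_face (affine_values pos) G >], G != finset.set0 & G \subset G1].
have PG1 : P G1.
  apply/and3P; split=> //; first exact/asboolP.
  by apply/set0Pn; exists m0; rewrite inE m0G eqxx.
have [G /and3P[/asboolP faceG /set0Pn[m mG] GG1] minG] := arg_minnP (fun G : {set T} => #|G|) PG1.
have same j : j \in G -> pos j = pos m.
  move=> jG; apply/eqP; rewrite -subr_eq0; apply: contraT => jm.
  have [m' m'G [min' face']] := is_face_argmin aff faceG (affc (pos j - pos m)) jG.
  set G' := finset _ in face'.
  have G'G : G' \subset G by apply/fintype.subsetP => u; rewrite inE => /andP[].
  have : (#|G| <= #|G'|)%N.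
    apply: minG; apply/and3P; split; first exact/asboolP.
      by apply/set0Pn; exists m'; rewrite inE m'G eqxx.
    exact: fintype.subset_trans GG1.
  move=> /(conj G'G)/andP; rewrite -eqEcard => /eqP G'E.
  move: mG jG; rewrite -G'E !inE => /andP[_ /eqP mE] /andP[_ /eqP jE].
  have := dotBr (pos j - pos m) (pos j) (pos m); rewrite jE mE subrr.
  by move/dot_self_eq0/eqP; rewrite (negPf jm).
have [g [c1 [b1 gE]] [g_ge0 gG]] := faceG.
have mG1 : m \in G1 by apply: (fintype.subsetP GG1).
move: mG1; rewrite !inE => /andP[/eqP mb0 /eqP mc].
exists (pos m); last first.
  split; first by apply/eqP; rewrite eq_sym -subr_eq0 mb0.
  by have := min0 i i0; rewrite -mc !dotNl lerN2.
exists (- c1), b1.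
have Mhull x : conv_hull (range pos) x ->
    dot (- c1) x <= b1 /\ (dot (- c1) x = b1 -> x = pos m).
  apply: (@conv_hull_le_eq _ _ _ [set pos m]) => [x' y t _ _ -> ->|_ [j _ <-]].
    by rewrite -scalerDl addrC subrK scale1r.
  have := g_ge0 j; have := gG j; rewrite gE dotNl => jG gj; split; first by lra.
  by move=> eqb; apply: same; rewrite jG; apply/eqP; lra.
split=> [x /Mhull[]//|]; apply/seteqP; split=> [x ->|x [/Mhull[_ xm] /xm]] //=.
split; first by apply: sub_conv_hull; exists m.
by move: mG; rewrite gG gE => /eqP; rewrite dotNl; lra.
Qed.

End Convexity.

(** * From polytopes to spaces of functions on the vertices *)

Section Polytopes.
Context {R : realType} {n : nat}.
Implicit Types (A E F G P : set 'rV[R]_n) (u v w x y c : 'rV[R]_n) (t b : R).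

Lemma polytope_range P : polytope P ->
  exists m (p : 'I_m -> 'rV[R]_n), P = conv_hull (range p).
Proof.
move=> [A /finite_seqP[s ->] ->]; exists (size s), (fun i => nth 0 s i).
congr conv_hull; apply/seteqP; split=> [x /= xs|_ [i _ <-]] /=.
  have xlt : (index x s < size s)%N by rewrite index_mem.
  by exists (Ordinal xlt) => //=; rewrite nth_index.
exact: mem_nth.
Qed.

Lemma faces_sub P F : faces P F -> F `<=` P.
Proof. by move=> [c [b [_ ->]]] x []. Qed.

Lemma vertices_sub P v : vertices P v -> P v.
Proof. by move/faces_sub; apply. Qed.

Lemma faces_self P : faces P P.
Proof.
exists 0, 0; split=> [x _|]; first by rewrite dot0l.
by apply/seteqP; split=> [x Px|x []//]; split=> //=; rewrite dot0l.
Qed.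

(** The maximum of a linear function on a face is attained at a vertex.  This
    stands in for the theorem that a polytope is the convex hull of its
    vertices. *)
Lemma face_le P F c b : polytope P -> faces P F ->
  (forall v, vertices P v -> F v -> dot c v <= b) ->
  forall x, F x -> dot c x <= b.
Proof.
move=> /polytope_range[m [p PE]] [c0 [b0 [P_le ->]]] Vle x [Px /= x0].
move: Px; rewrite PE => Px.
have [||_ /(_ x0)//] := @conv_hull_le_eq _ _ (range p) c0 b0 [set y | dot c y <= b] _ _ x Px.
  move=> y z t t0 t1 /= yb zb; rewrite dotDr !dotZr.
  have : t * dot c y <= t * b by rewrite ler_pM2l.
  have : (1 - t) * dot c z <= (1 - t) * b by rewrite ler_pM2l // subr_gt0.
  lra.
have p_le j : dot c0 (p j) <= b0.
  by apply: P_le; rewrite PE; apply: sub_conv_hull; exists j.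
move=> _ [j _ <-]; split=> //= eq0.
have [v Vv [v0 jv]] := exposed_vertex c p_le eq0.
rewrite -PE in Vv; apply: le_trans jv (Vle v Vv _).
by split=> //; apply: vertices_sub.
Qed.

Lemma faces_subset P F G : polytope P -> faces P F -> faces P G ->
  (forall v, vertices P v -> F v -> G v) -> F `<=` G.
Proof.
move=> polP faceF [c [b [P_le GE]]] VFG x Fx.
rewrite GE; have Px := faces_sub faceF Fx; split=> //=.
apply/eqP; rewrite eq_le P_le //= -lerN2 -dotNl.
apply: (face_le polP faceF) Fx => v Vv Fv.
by rewrite dotNl lerN2; have := VFG v Vv Fv; rewrite GE => -[_ /= ->].
Qed.

Lemma faces_eq P F G : polytope P -> faces P F -> faces P G ->
  (forall v, vertices P v -> (F v <-> G v)) -> F = G.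
Proof.
move=> polP faceF faceG VFG; apply/seteqP.
by split; apply: (faces_subset polP) => // v /VFG[].
Qed.

Section Indexed.
Variables (P : set 'rV[R]_n) (T : finType) (pos : T -> 'rV[R]_n).
Hypotheses (polP : polytope P) (pos_inj : injective pos)
  (pos_range : vertices P = range pos).

Local Notation L := (affine_values pos).

Lemma pos_vertex i : vertices P (pos i).
Proof. by rewrite pos_range; exists i. Qed.

Lemma pos_in i : P (pos i).
Proof. exact/(@vertices_sub P)/pos_vertex. Qed.

Lemma is_face_of_faces F : faces P F -> is_face L [set i | `[< F (pos i) >]]%SET.
Proof.
move=> [c [b [P_le ->]]]; exists (fun i => b - dot c (pos i)).
  by exists (- c), b => i; rewrite dotNl addrC.
split=> i; first by rewrite subr_ge0 P_le //; apply: pos_in.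
rewrite inE subr_eq0 eq_sym; apply/asboolP/eqP => [[]//|eqb].
by split=> //; apply: pos_in.
Qed.

Lemma faces_of_is_face (G : {set T}) : is_face L G ->
  exists2 F, faces P F & forall i, (i \in G) = `[< F (pos i) >].
Proof.
move=> [g [c [b gE]] [g_ge0 gG]].
exists (P `&` [set x | dot (- c) x = b]).
  exists (- c), b; split=> // x Px.
  apply: (face_le polP (faces_self P)) Px => v; rewrite pos_range => -[i _ <-] _.
  by have := g_ge0 i; rewrite gE dotNl; lra.
move=> i; rewrite gG gE; apply/eqP/asboolP => [eq0|[_ /=]].
  by split=> /=; [apply: pos_in|rewrite dotNl; lra].
by rewrite dotNl; lra.
Qed.

Lemma expose_vertex i :
  exists2 h, L h & h i = 0 /\ forall j, j != i -> 0 < h j.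
Proof.
have [c [b [P_le vE]]] := pos_vertex i.
have vb : dot c (pos i) = b.
  by have : [set pos i] (pos i) by []; rewrite vE => -[].
exists (fun j => b - dot c (pos j)).
  by exists (- c), b => j; rewrite dotNl addrC.
split=> [|j ji]; first by rewrite vb subrr.
rewrite subr_gt0 lt_neqAle P_le ?andbT; last exact: pos_in.
apply: contraNN ji => /eqP jb.
have : (P `&` [set x | dot c x = b]) (pos j) by split=> //; apply: pos_in.
by rewrite -vE => /pos_inj->.
Qed.

(** A third vertex on the line of an edge would put one of the three vertices
    between the other two. *)
Lemma adjacent_iff i j :
  adjacent P (pos i) (pos j) <-> i != j /\ is_face L [set i; j]%SET.
Proof.
split=> [[_ _ ij [F [faceF [v Fv [U dimU affF]]] [Fi Fj]]]|[ij faceij]].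
  have {}ij : i != j by apply/eqP => eq_ij; apply: ij; rewrite eq_ij.
  split=> //.
  have -> : [set i; j]%SET = [set l | `[< F (pos l) >]]%SET; last first.
    exact: is_face_of_faces.
  apply/setP => l; rewrite !inE; apply/orP/asboolP => [[]/eqP->//|Fl].
  apply/orP; apply: contraT; rewrite negb_or => /andP[li lj].
  have flatF x : F x -> exists2 u, u \in U & x = v + u.
    move=> Fx; have : flat v U x by rewrite -affF; apply: sub_gen_smallest.
    by case=> u Uu <-; exists u.
  have [ui Ui iE] := flatF _ Fi; have [uj Uj jE] := flatF _ Fj.
  have [ul Ul lE] := flatF _ Fl.
  have diff : pos j - pos i != 0.
    by rewrite subr_eq0; apply: contraNneq ij => /pos_inj->.
  have UE : U = <[pos j - pos i]>%VS.
    apply/esym/eqP; rewrite eqEdim -memvE dimU dim_vline diff.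
    by rewrite iE jE opprD addrACA subrr add0r rpredB.
  have : pos l - pos i \in U by rewrite iE lE opprD addrACA subrr add0r rpredB.
  rewrite UE => /vlineP[mu muE].
  have aff h : L h -> h l = h i + mu * (h j - h i).
    move=> [c [b hE]]; rewrite !hE.
    have := congr1 (dot c) muE; rewrite dotZr !dotBr.
    lra.
  have [hi Lhi [hi0 hi_gt0]] := expose_vertex i.
  have [hj Lhj [hj0 hj_gt0]] := expose_vertex j.
  have [hl Lhl [hl0 hl_gt0]] := expose_vertex l.
  have mu_gt0 : 0 < mu.
    have := hi_gt0 l li; rewrite (aff _ Lhi) hi0 subr0 add0r.
    by rewrite pmulr_lgt0 // hi_gt0 // eq_sym.
  have mu_lt1 : mu < 1.
    have := hj_gt0 l lj; rewrite (aff _ Lhj) hj0 => H.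
    rewrite -subr_gt0 -(pmulr_rgt0 _ (hj_gt0 i ij)); lra.
  have Hi : 0 < hl i by rewrite hl_gt0 // eq_sym.
  have Hj : 0 < hl j by rewrite hl_gt0 // eq_sym.
  have : 0 < (1 - mu) * hl i by rewrite mulr_gt0 // subr_gt0.
  have : 0 < mu * hl j by rewrite mulr_gt0.
  have := aff _ Lhl; rewrite hl0; lra.
have [F faceF FE] := faces_of_is_face faceij.
have Fi : F (pos i) by apply/asboolP; rewrite -FE set21.
have Fj : F (pos j) by apply/asboolP; rewrite -FE set22.
split; [exact: pos_vertex|exact: pos_vertex| |].
  by move=> /pos_inj eq_ij; rewrite eq_ij eqxx in ij.
exists F => //; split=> //; exists (pos i) => //.
exists <[pos j - pos i]>%VS.
  rewrite dim_vline subr_eq0; case: eqP => // /pos_inj eq_ji.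
  by rewrite eq_ji eqxx in ij.
apply/seteqP; split.
  apply: smallest_sub; first by exists (pos i), <[pos j - pos i]>%VS.
  move=> x Fx; exists (x - pos i); last by rewrite addrC subrK.
  rewrite /=; apply: contraT => /dot_separates[c cU]; rewrite dotBr.
  have cij : dot c (pos j) = dot c (pos i).
    by have := cU _ (memv_line _); rewrite dotBr => /eqP; rewrite subr_eq0 => /eqP.
  have VF v : vertices P v -> F v -> dot c v = dot c (pos i).
    rewrite pos_range => -[l _ <-] Fl.
    have : l \in [set i; j]%SET by rewrite FE; apply/asboolP.
    by case/set2P => ->.
  have := face_le polP faceF (c := c) (b := dot c (pos i)) _ Fx.
  have := face_le polP faceF (c := - c) (b := - dot c (pos i)) _ Fx.
  rewrite dotNl lerN2 => le1 le2; rewrite subr_eq0 eq_le le1 ?le2 //.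
    by move=> v Vv Fv; rewrite VF.
  by move=> v Vv Fv; rewrite dotNl VF.
move=> _ [w /vlineP[t ->] <-] _ [[v [U ->]]] FU.
have [ui Ui iE] := FU _ Fi; have [uj Uj jE] := FU _ Fj.
exists (ui + t *: (uj - ui)); first by rewrite /= rpredD // rpredZ // rpredB.
by rewrite -iE -jE opprD addrACA subrr add0r addrA.
Qed.

(** If the affine functions vanishing on [X] vanished at all vertices, the affine
    hull of [P] would be spanned by [X] and have dimension less than [d]. *)
Lemma affine_dim d (X : {set T}) : has_dim P d -> (#|X| <= d)%N ->
  exists2 g, L g & (exists z, g z != 0) /\ (forall i, i \in X -> g i = 0).
Proof.
move=> [v Pv [U dimU affP]] leX.
have [i0] : exists i : T, True.
  apply: contrapT => T0.
  have : 0 <= -1 :> R.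
    rewrite -[leLHS](dot0l v); apply: (face_le polP (faces_self P)) Pv => w.
    by rewrite pos_range => -[i _ _]; case: T0; exists i.
  by rewrite ler0N1.
move=> _; have [X0|/finset.set0Pn[x0 x0X]] := eqVneq X finset.set0.
  exists (fun=> 1); first by exists 0, 1 => i; rewrite dot0l add0r.
  by split=> [|x]; [exists i0; apply: oner_neq0|rewrite X0 inE].
pose W := <<[seq pos i - pos x0 | i <- enum (X :\ x0)%SET]>>%VS.
have dimW : (\dim W < d)%N.
  apply: leq_trans leX; rewrite (cardsD1 x0) x0X add1n ltnS cardE.
  by apply: leq_trans (dim_span _) _; rewrite size_map.
have [i iW] : exists i, pos i - pos x0 \notin W.
  apply: contrapT => allW.
  have {}allW i : pos i - pos x0 \in W.
    by apply: contraT => iW; case: allW; exists i.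
  suff UW : (U <= W)%VS by have := dimvS UW; rewrite dimU leqNgt dimW.
  have PW x : P x -> x - pos x0 \in W.
    move=> Px; apply: contraT => /dot_separates[c cW]; rewrite dotBr.
    have VF w : vertices P w -> P w -> dot c w = dot c (pos x0).
      rewrite pos_range => -[l _ <-] _.
      by have := cW _ (allW l); rewrite dotBr => /eqP; rewrite subr_eq0 => /eqP.
    have := face_le polP (faces_self P) (c := c) (b := dot c (pos x0)) _ Px.
    have := face_le polP (faces_self P) (c := - c) (b := - dot c (pos x0)) _ Px.
    rewrite dotNl lerN2 => le1 le2; rewrite subr_eq0 eq_le le1 ?le2 //.
      by move=> w Vw Fw; rewrite VF.
    by move=> w Vw Fw; rewrite dotNl VF.
  have affW x : flat v U x -> x - pos x0 \in W.
    rewrite -affP => affx; suff [w Ww <-] : flat (pos x0) W x.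
      by rewrite addrC addKr.
    apply: affx; split; first by exists (pos x0), W.
    by move=> y Py; exists (y - pos x0); [exact: PW|rewrite addrC subrK].
  apply/subvP => u Uu.
  have -> : u = (v + u - pos x0) - (v + 0 - pos x0).
    by rewrite addr0 opprB addrA subrK addrC addKr.
  by rewrite rpredB // affW //; [exists u|exists 0 => //=; apply: mem0v].
have [c cW ci] := dot_separates iW.
exists (fun l => dot c (pos l) - dot c (pos x0)).
  by exists c, (- dot c (pos x0)).
split=> [|x xX]; first by exists i; rewrite -dotBr.
have [->|xx0] := eqVneq x x0; first by rewrite subrr.
rewrite -dotBr cW //; apply: memv_span; apply: map_f.
by rewrite mem_enum in_setD1 xx0.
Qed.

Lemma polytope_vertex_space d (e : rel T) : has_dim P d ->
  (forall i j, e i j <-> adjacent P (pos i) (pos j)) -> vertex_space d L e.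
Proof.
move=> dimP eE; split; first exact: affine_values_space.
- exact: expose_vertex.
- by move=> X; apply: affine_dim.
- by move=> i j; rewrite eE adjacent_iff.
Qed.

Lemma card_pos (B : {set T}) m : (pos @` [set` B]) #= `I_m <-> #|B| = m.
Proof.
have cardB : pos @` [set` B] #= `I_#|B|.
  have -> : pos @` [set` B] = range (fun i : 'I_#|B| => pos (enum_val i)).
    apply/seteqP; split=> [_ [i /= iB <-]|_ [i _ <-]].
      by exists (enum_rank_in iB i); rewrite // enum_rankK_in.
    by exists (enum_val i) => //=; apply: enum_valP.
  rewrite (card_eql (inj_card_eq _)); last by move=> i j _ _ /pos_inj/enum_val_inj.
  by rewrite card_eq_sym card_II.
split=> [Bm|<- //]; apply/card_eq_II.
by rewrite -(card_eql cardB).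
Qed.

Lemma simple_vertex_iff d (e : rel T) i :
  (forall i j, e i j <-> adjacent P (pos i) (pos j)) ->
  simple_vertex d P (pos i) <-> i \in simple_set d e.
Proof.
move=> eE; rewrite /simple_vertex inE.
have -> : [set u | adjacent P (pos i) u] = pos @` [set` nbr e i].
  apply/seteqP; split=> [u /[dup] iu [_]|_ [j /= ij <-]].
    rewrite pos_range => -[j _ eq_u] _ _; exists j => //=.
    by rewrite inE; apply/eE; rewrite eq_u.
  by apply/eE; rewrite inE in ij.
rewrite card_pos; split=> [[_ ->]//|/eqP->]; split=> //; exact: pos_vertex.
Qed.

Lemma card_nonsimple_vertices d (e : rel T) s :
  (forall i j, e i j <-> adjacent P (pos i) (pos j)) ->
  nonsimple_vertices d P #= `I_s <-> #|~: simple_set d e| = s.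
Proof.
move=> eE; rewrite -card_pos.
suff -> : nonsimple_vertices d P = pos @` [set` (~: simple_set d e)%SET] by [].
apply/seteqP; split=> [u [Vu nu]|_ [i /= iS <-]].
  move: Vu nu; rewrite {1}pos_range => -[i _ <-] nu; exists i => //=.
  by rewrite finset.in_setC; apply/negP => /(simple_vertex_iff d i eE).
split; first exact: pos_vertex.
by move=> /(simple_vertex_iff d i eE); apply/negP; rewrite finset.in_setC in iS.
Qed.

End Indexed.

Lemma vertices_index P m : vertices P #= `I_m ->
  exists2 pos : 'I_m -> 'rV[R]_n, injective pos & vertices P = range pos.
Proof.
move=> /card_set_bijP[g [gV g_inj g_surj]].
have /choice[pos posP] (i : 'I_m) : exists v, vertices P v /\ g v = i.
  by have [v Vv gv] := g_surj i (ltn_ord i); exists v.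
exists pos => [i j eq_ij|].
  by apply/ord_inj; rewrite -(posP i).2 -(posP j).2 eq_ij.
apply/seteqP; split=> [v Vv|_ [i _ <-]]; last by have [] := posP i.
have gm : (g v < m)%N := gV v Vv.
exists (Ordinal gm) => //; have [Vp gp] := posP (Ordinal gm).
by apply: g_inj; rewrite ?inE.
Qed.

End Polytopes.

(** The vertices of [Q] are indexed through [phi], so that both polytopes give
    spaces of functions on the same type with the same adjacency relation. *)
Theorem reconstructible_few_nonsimple (R : realType) (k d n s : nat)
    (P : set 'rV[R]_n) :
  (5 <= k)%N -> d_polytope d P -> vertices P #= `I_(d + k)%N ->
  nonsimple_vertices d P #= `I_s -> (s + k <= d + 3)%N -> reconstructible d P.
Proof.
move=> k5 [polP dimP] /vertices_index[p p_inj p_range] cardS le_s m Q phi.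
move=> [polQ dimQ] [phi_bij phi_adj].
have pV i : vertices P (p i) by rewrite p_range; exists i.
pose q i := phi (p i).
have [phiV phi_inj phi_surj] := phi_bij.
have q_inj : injective q.
  by move=> i j /phi_inj; rewrite !inE => /(_ (pV i) (pV j))/p_inj.
have q_range : vertices Q = range q.
  apply/seteqP; split=> [w /phi_surj[v]|_ [i _ <-]]; last exact: phiV.
  by rewrite p_range => -[i _ <-] <-; exists i.
pose e : rel 'I_(d + k) := fun i j => `[< adjacent P (p i) (p j) >].
have eP i j : e i j <-> adjacent P (p i) (p j) by split=> /asboolP.
have eQ i j : e i j <-> adjacent Q (q i) (q j) by rewrite eP phi_adj.
have VSp := polytope_vertex_space polP p_inj p_range dimP eP.
have VSq := polytope_vertex_space polQ q_inj q_range dimQ eQ.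
have cardT : #|'I_(d + k)| = (d + k)%N by rewrite card_ord.
have card_ns : (#|~: simple_set d e| + k <= d + 3)%N.
  by have /(card_nonsimple_vertices p_inj p_range d s eP)-> := cardS.
have PQ := faces_determined cardT card_ns k5 VSp VSq.
have QP := faces_determined cardT card_ns k5 VSq VSp.
have /choice[Phi PhiP] : forall F, exists G, faces P F ->
    faces Q G /\ forall i, G (q i) <-> F (p i).
  move=> F; have [faceF|] := pselect (faces P F); last by exists set0.
  have [G faceG GE] := faces_of_is_face polQ q_range (PQ _ (is_face_of_faces p_range faceF)).
  exists G => _; split=> // i; have GEi := GE i; rewrite inE in GEi.
  by split=> /asboolP H; apply/asboolP; [rewrite GEi|rewrite -GEi].
have faceP F G : faces P F -> faces P G -> (forall i, F (p i) <-> G (p i)) -> F = G.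
  move=> faceF faceG FG; apply: (faces_eq polP) => // v.
  by rewrite p_range => -[i _ <-].
have faceQ F G : faces Q F -> faces Q G -> (forall i, F (q i) <-> G (q i)) -> F = G.
  move=> faceF faceG FG; apply: (faces_eq polQ) => // v.
  by rewrite q_range => -[i _ <-].
exists Phi; last first.
  move=> v; rewrite {1}p_range => -[i _ <-].
  have [faceG GE] := PhiP _ (pV i).
  apply: faceQ => //; first by have := phiV _ (pV i).
  by move=> j; rewrite GE /=; split=> [/p_inj->//|/q_inj->].
split; last first.
  move=> F G faceF faceG; have [faceF' FE] := PhiP _ faceF.
  have [faceG' GE] := PhiP _ faceG; split=> FG.
    apply: (faces_subset polQ) => // v; rewrite q_range => -[i _ <-] /FE.
    by move=> /FG /GE.
  apply: (faces_subset polP) => // v; rewrite p_range => -[i _ <-] /FE.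
  by move=> /FG /GE.
split=> [F /PhiP[]//|F G|G faceG].
  rewrite !inE => faceF faceG eqPhi; have [_ FE] := PhiP _ faceF.
  have [_ GE] := PhiP _ faceG; apply: faceP => // i.
  by rewrite -FE eqPhi GE.
have [F faceF FE] := faces_of_is_face polP p_range (QP _ (is_face_of_faces q_range faceG)).
have [faceG' GE] := PhiP _ faceF; exists F => //; apply: faceQ => // i.
have FEi := FE i; rewrite inE in FEi.
by rewrite GE; split=> /asboolP H; apply/asboolP; [rewrite FEi|rewrite -FEi].
Qed.

(** * Polytopes given by generators, and comparison of face lattices *)

Section Generators.
Context {R : realType} {n : nat} {T : finType}.
Variable pos : T -> 'rV[R]_n.

Local Notation P := (conv_hull (range pos)).
Local Notation L := (affine_values pos).

Lemma polytope_conv_range : polytope P.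
Proof. by exists (range pos) => //; apply: finite_image. Qed.

Hypothesis face1 : forall i, is_face L [set i]%SET.

Lemma generators_inj : injective pos.
Proof.
move=> i j eq_ij; have [g [c [b gE]] [_ gF]] := face1 j.
apply/eqP; rewrite -finset.in_set1 gF gE eq_ij -gE -gF.
by rewrite finset.in_set1.
Qed.

Lemma generators_vertices : vertices P = range pos.
Proof.
apply/seteqP; split=> [v [c [b [P_le vE]]]|_ [i _ <-]].
  have [[i ib]|nob] := pselect (exists i, dot c (pos i) = b).
    exists i => //; have : (P `&` [set x | dot c x = b]) (pos i).
      by split=> //; apply: sub_conv_hull; exists i.
    by rewrite -vE.
  have : [set v] v by [].
  rewrite vE => -[Pv /= vb].
  have [|_ [i _ <-]|_ /(_ vb)//] := @conv_hull_le_eq _ _ (range pos) c b set0 _ _ v Pv.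
    by [].
  split=> [|ib]; first by apply: P_le; apply: sub_conv_hull; exists i.
  by apply: nob; exists i.
have [g [c [b gE]] [g_ge0 gF]] := face1 i.
have Phull x : P x -> dot (- c) x <= b /\ (dot (- c) x = b -> x = pos i).
  apply: (@conv_hull_le_eq _ _ _ _ _ [set pos i]) => [x' y t _ _ -> ->|_ [j _ <-]].
    by rewrite -scalerDl addrC subrK scale1r.
  have := g_ge0 j; have := gF j; rewrite gE dotNl => jF gj; split; first by lra.
  move=> eqb; suff : j \in [set i]%SET by rewrite finset.in_set1 => /eqP->.
  by rewrite jF; apply/eqP; lra.
exists (- c), b; split=> [x /Phull[]//|].
apply/seteqP; split=> [x ->|x [/Phull[_ xi] /xi]] //=.
split; first by apply: sub_conv_hull; exists i.
by have := gF i; rewrite finset.in_set1 eqxx gE => /esym/eqP; rewrite /= dotNl; lra.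
Qed.
End Generators.

Section IndexedIso.
Context {R : realType} {n m : nat} {T : finType}.
Variables (P : set 'rV[R]_n) (Q : set 'rV[R]_m)
  (p : T -> 'rV[R]_n) (q : T -> 'rV[R]_m) (e : rel T).
Hypotheses (polP : polytope P) (polQ : polytope Q)
  (p_inj : injective p) (q_inj : injective q)
  (p_range : vertices P = range p) (q_range : vertices Q = range q)
  (eP : forall i j, e i j <-> adjacent P (p i) (p j))
  (eQ : forall i j, e i j <-> adjacent Q (q i) (q j)).

Lemma same_graph_indexed : same_graph P Q.
Proof.
have /choice[phi phiP] : forall v, exists w, forall i, p i = v -> w = q i.
  move=> v; have [[i iv]|nov] := pselect (exists i, p i = v).
    by exists (q i) => j; rewrite -iv => /p_inj->.
  by exists 0 => i iv; case: nov; exists i.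
have phi_p i : phi (p i) = q i by apply: phiP.
exists phi; split; last first.
  by move=> u v; rewrite p_range => -[i _ <-] [j _ <-]; rewrite !phi_p -eP eQ.
rewrite p_range q_range; split=> [_ [i _ <-]|u v|_ [i _ <-]].
- by rewrite /= phi_p; exists i.
- by rewrite !inE => -[i _ <-] [j _ <-]; rewrite !phi_p => /q_inj->.
- by exists (p i); [exists i|].
Qed.

Lemma faces_set0 k (X : set 'rV[R]_k) : faces X set0.
Proof.
exists 0, 1; split=> [x _|]; first by rewrite dot0l ler01.
apply/seteqP; split=> // x [_ /=]; rewrite dot0l => /eqP.
by rewrite eq_sym oner_eq0.
Qed.

(** An isomorphism of face lattices maps the empty face to the empty face and the
    minimal nonempty faces, which are the vertices, to each other. *)
Lemma comb_equivalent_perm : comb_equivalent P Q ->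
  exists2 pi : T -> T, injective pi & forall X : {set T},
    is_face (affine_values p) X <-> is_face (affine_values q) (pi @: X)%SET.
Proof.
move=> [Phi [[PhiQ Phi_inj Phi_surj] Phi_mono]].
have Phi_eq F G : faces P F -> faces P G -> Phi F = Phi G -> F = G.
  by move=> faceF faceG; apply: Phi_inj; apply/mem_set.
have Phi0 : Phi set0 = set0.
  have [F faceF F0] := Phi_surj _ (faces_set0 Q).
  rewrite -subset0 -[X in _ `<=` X]F0.
  by apply/(Phi_mono _ _ (faces_set0 P) faceF).
have pV i : vertices P (p i) by rewrite p_range; exists i.
have qV i : vertices Q (q i) by rewrite q_range; exists i.
have /choice[pi piP] : forall i, exists j, Phi [set p i] = [set q j].
  move=> i; have faceQ := PhiQ _ (pV i).
  have [[j Pj]|noj] := pselect (exists j, Phi [set p i] (q j)); last first.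
    suff : Phi [set p i] = Phi set0.
      move/(Phi_eq _ _ (pV i) (faces_set0 P))/seteqP => -[/(_ (p i))H _].
      by case: H.
    rewrite Phi0; apply: (faces_eq polQ faceQ (faces_set0 Q)) => v.
    rewrite q_range => -[j _ <-]; split=> // qj; case: noj; by exists j.
  exists j; have [F faceF FE] := Phi_surj _ (qV j).
  suff <- : F = [set p i] by [].
  have Fi : F `<=` [set p i].
    by apply/(Phi_mono _ _ faceF (pV i)); rewrite FE => _ ->.
  apply/seteqP; split=> // _ ->; apply: contrapT => nFi.
  have F0 : F = set0.
    by apply/seteqP; split=> // x Fx; have := Fi x Fx => /= xi; case: nFi; rewrite -xi.
  by have : [set q j] (q j) by []; rewrite -FE F0 Phi0.
have pi_inj : injective pi.
  move=> i j eq_ij; apply: p_inj.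
  have : [set p i] (p i) by [].
  by rewrite (Phi_eq _ _ (pV i) (pV j)) // !piP eq_ij.
have PhiE F i : faces P F -> (F (p i) <-> Phi F (q (pi i))).
  move=> faceF; split=> Fi.
    have : [set q (pi i)] `<=` Phi F.
      by rewrite -piP; apply/(Phi_mono _ _ (pV i) faceF) => _ ->.
    by apply.
  have : [set p i] `<=` F by apply/(Phi_mono _ _ (pV i) faceF); rewrite piP => _ ->.
  by apply.
exists pi => // X; split=> [faceX|faceX].
  have [F faceF FE] := faces_of_is_face polP p_range faceX.
  suff -> : (pi @: X)%SET = [set j | `[< Phi F (q j) >]]%SET.
    exact: is_face_of_faces q_range _ (PhiQ _ faceF).
  apply/finset.setP => j; have /codomP[i ->] := inj_card_onto pi_inj (leqnn _) j.
  rewrite (mem_imset _ _ pi_inj) inE FE.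
  by apply/asboolP/asboolP => /(PhiE F i faceF).
have [G faceG GE] := faces_of_is_face polQ q_range faceX.
have [F faceF FG] := Phi_surj _ faceG.
suff -> : X = [set i | `[< F (p i) >]]%SET by apply: (is_face_of_faces p_range).
apply/finset.setP => i; rewrite inE -(mem_imset X i pi_inj) GE -FG.
by apply/asboolP/asboolP => /(PhiE F i faceF).
Qed.

(** The bijection of vertices induced by an isomorphism of face lattices preserves
    the edges and therefore the degrees. *)
Lemma comb_equivalent_nonsimple d : comb_equivalent P Q ->
  is_face (affine_values p) (~: simple_set d e)%SET <->
  is_face (affine_values q) (~: simple_set d e)%SET.
Proof.
move=> /comb_equivalent_perm[pi pi_inj piP].
have e_pi i j : e i j = e (pi i) (pi j).
  apply/idP/idP.
    move=> /eP/(adjacent_iff polP p_inj p_range)[ij face_ij].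
    apply/eQ/(adjacent_iff polQ q_inj q_range); rewrite (inj_eq pi_inj).
    by split=> //; move/piP: face_ij; rewrite imsetU1 imset_set1.
  move=> /eQ/(adjacent_iff polQ q_inj q_range)[]; rewrite (inj_eq pi_inj).
  move=> ij face_ij; apply/eP/(adjacent_iff polP p_inj p_range); split=> //.
  by apply/piP; rewrite imsetU1 imset_set1.
suff {2}<- : (pi @: ~: simple_set d e)%SET = (~: simple_set d e)%SET by [].
apply/finset.setP => j; have /codomP[i ->] := inj_card_onto pi_inj (leqnn _) j.
rewrite (mem_imset _ _ pi_inj) !inE.
suff -> : nbr e (pi i) = (pi @: nbr e i)%SET by rewrite card_imset.
apply/finset.setP => k; have /codomP[l ->] := inj_card_onto pi_inj (leqnn _) k.
by rewrite (mem_imset _ _ pi_inj) !inE -e_pi.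
Qed.
End IndexedIso.

(** * Certificates for faces of polytopes with integer generators *)

Fixpoint idot (u v : seq int) : int :=
  if u is a :: u' then if v is b :: v' then a * b + idot u' v' else 0 else 0.

Lemma idotE m u v : size u = m -> size v = m ->
  idot u v = \sum_(j < m) nth 0 u j * nth 0 v j.
Proof.
elim: m u v => [|m IHm] [|a u] [|b v] //=; first by rewrite big_ord0.
by move=> [su] [sv]; rewrite big_ord_recl /= (IHm u v).
Qed.

Section Certificates.
Variable (pts : seq (seq int)).

(** The homogeneous coordinates, so that a list of six integers stands for an
    affine function. *)
Definition homog i : seq int := rcons (nth [::] pts i) 1.

Definition column j : seq int := [seq nth 0 (homog i) j | i <- iota 0 10].

Definition well_sized : bool := all (fun i => size (nth [::] pts i) == 5%N) (iota 0 10).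

(** The sum of the facet functions that vanish on [X]; its zero set is the smallest
    face containing [X] when all facets are listed. *)
Definition exposing (fs : seq (seq int)) (X : seq nat) (i : nat) : int :=
  foldr (fun f acc => idot f (homog i) + acc) 0
    [seq f <- fs | all (fun j => idot f (homog j) == 0) X].

Definition face_cert fs X : bool :=
  all (fun f => (size f == 6%N) && all (fun i => 0 <= idot f (homog i)) (iota 0 10)) fs &&
  all (fun i => (i \in X) == (exposing fs X i == 0)) (iota 0 10).

(** An affine dependency [y] that is nonnegative outside [X] and nonzero there: a
    nonnegative affine function vanishing on [X] must vanish where [y] is positive
    outside [X]. *)
Definition nonface_cert (X : seq nat) (y : seq int) : bool :=
  [&& size y == 10%N, all (fun j => idot y (column j) == 0) (iota 0 6),
      all (fun i => (i \in X) || (0 <= nth 0 y i)) (iota 0 10) &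
      has (fun i => (i \notin X) && (0 < nth 0 y i)) (iota 0 10)].

(** The [k]-th list exhibits a multiple of the [k]-th basis vector as a
    combination of the points with coefficients of sum zero. *)
Definition span_cert (ys : seq (seq int)) : bool :=
  all (fun k => let y := nth [::] ys k in
    [&& size y == 10%N, idot y (column k) != 0 &
      all (fun j => (j == k) || (idot y (column j) == 0)) (iota 0 6)]) (iota 0 5).

Section Points.
Context {R : realType}.

Definition point (i : 'I_10) : 'rV[R]_5 :=
  \row_j (nth 0 (nth [::] pts i) j)%:~R.

Local Notation L := (affine_values point).

Hypothesis pts_size : well_sized.

Lemma homog_size (i : 'I_10) : size (homog i) = 6%N.
Proof.
have /allP/(_ (val i)) := pts_size; rewrite mem_iota ltn_ord => /(_ isT)/eqP.
by rewrite /homog size_rcons => ->.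
Qed.

Lemma homog_last (i : 'I_10) : nth 0 (homog i) 5 = 1.
Proof.
have /allP/(_ (val i)) := pts_size; rewrite mem_iota ltn_ord => /(_ isT)/eqP si.
by rewrite /homog nth_rcons si.
Qed.

Lemma homog_coord (i : 'I_10) (j : 'I_5) :
  (nth 0 (homog i) j)%:~R = point i 0 j :> R.
Proof.
have /allP/(_ (val i)) := pts_size; rewrite mem_iota ltn_ord => /(_ isT)/eqP si.
by rewrite mxE /homog nth_rcons si ltn_ord.
Qed.

Lemma affine_idot f : size f = 6%N -> L (fun i : 'I_10 => (idot f (homog i))%:~R).
Proof.
move=> sf; exists (\row_(j < 5) (nth 0 f j)%:~R), (nth 0 f 5)%:~R => i.
rewrite (idotE sf (homog_size i)) big_ord_recr /= homog_last mulr1 rmorphD /=.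
congr (_ + _); rewrite rmorph_sum; apply: eq_bigr => j _.
by rewrite rmorphM /= homog_coord mxE.
Qed.

Lemma affine_dependency y g : size y = 10%N ->
  all (fun j => idot y (column j) == 0) (iota 0 6) -> L g ->
  \sum_(i < 10) (nth 0 y i)%:~R * g i = 0.
Proof.
move=> sy /allP y0 [c [b gE]].
have colE j : (j < 6)%N -> \sum_(i < 10) nth 0 y i * nth 0 (homog i) j = 0.
  move=> j6; have := y0 j; rewrite mem_iota j6 => /(_ isT)/eqP.
  rewrite (@idotE 10) // ?size_map ?size_iota // => sum0; rewrite -[RHS]sum0.
  by apply: eq_bigr => i _; rewrite (nth_map 0%N) ?size_iota // nth_iota.
under eq_bigr => i _ do rewrite gE mulrDr /dot mulr_sumr.
rewrite big_split exchange_big /= big1 ?add0r => [|j _].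
  rewrite -mulr_suml; have := congr1 (fun z => z%:~R : R) (colE 5 isT).
  rewrite rmorph_sum /= => sum0; rewrite (_ : \sum_(i < 10) _ = 0) ?mul0r //.
  by rewrite -[RHS]sum0; apply: eq_bigr => i _; rewrite homog_last mulr1.
have := congr1 (fun z => z%:~R * c 0 j : R) (colE j (leqW (ltn_ord j))).
rewrite rmorph_sum /= mul0r mulr_suml => sum0; rewrite -[RHS]sum0.
by apply: eq_bigr => i _; rewrite rmorphM /= homog_coord mulrAC mulrA.
Qed.

Lemma face_certP fs X : face_cert fs X ->
  is_face L [set i : 'I_10 | val i \in X]%SET.
Proof.
move=> /andP[/allP fs_ok /allP X_ok].
exists (fun i : 'I_10 => (exposing fs X i)%:~R).
  rewrite /exposing; set gs := filter _ _.
  have gs_ok f : f \in gs -> size f = 6%N.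
    by rewrite mem_filter => /andP[_ /fs_ok/andP[/eqP]].
  elim: gs gs_ok => [|f gs IHgs] gs_ok /=.
    exact: (aff_cst (affine_values_space _)).
  apply: (@aff_ext _ _ _ (fun i : 'I_10 => (idot f (homog i))%:~R +
    (foldr (fun f acc => idot f (homog i) + acc) 0 gs)%:~R)).
    by move=> i; rewrite rmorphD.
  apply: aff_add; first exact: affine_values_space.
    by apply: affine_idot; rewrite gs_ok ?mem_head.
  by apply: IHgs => h hgs; rewrite gs_ok // inE hgs orbT.
split=> i; last first.
  by rewrite inE intr_eq0; apply/eqP/X_ok; rewrite mem_iota ltn_ord.
rewrite ler0z /exposing; set gs := filter _ _.
have gs_ok f : f \in gs -> 0 <= idot f (homog i).
  rewrite mem_filter => /andP[_ /fs_ok/andP[_ /allP f_ok]].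
  by apply: f_ok; rewrite mem_iota ltn_ord.
elim: gs gs_ok => [|f gs IHgs] gs_ok //=.
rewrite addr_ge0 ?gs_ok ?mem_head //.
by apply: IHgs => h hgs; rewrite gs_ok // inE hgs orbT.
Qed.

Lemma nonface_certP X y : nonface_cert X y ->
  ~ is_face L [set i : 'I_10 | val i \in X]%SET.
Proof.
move=> /and4P[/eqP sy y0 /allP y_ge0 /hasP[k]]; rewrite mem_iota => k10.
move=> /andP[kX yk] [g Lg [g_ge0 gX]].
have term_ge0 (i : 'I_10) : 0 <= (nth 0 y i)%:~R * g i.
  case: (boolP (val i \in X)) => iX.
    by have := gX i; rewrite inE iX => /esym/eqP->; rewrite mulr0.
  rewrite mulr_ge0 // ler0z; have := y_ge0 (val i).
  by rewrite mem_iota ltn_ord (negPf iX) => /(_ isT).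
have := affine_dependency sy y0 Lg.
move/psumr_eq0P => /(_ (fun i _ => term_ge0 i)) all0.
have := all0 (Ordinal k10) isT; move/eqP; rewrite mulf_eq0 intr_eq0 /=.
rewrite (gt_eqF yk) /= -gX inE /=.
by rewrite (negPf kX).
Qed.

Lemma span_certP ys : span_cert ys ->
  has_dim (conv_hull (range point)) 5.
Proof.
move=> /allP ys_ok; exists (point ord0).
  by apply: sub_conv_hull; exists ord0.
exists fullv; first by rewrite dimvf.
apply/seteqP; split=> [x _|x _ F [[v [W ->]]] PF].
  by exists (x - point ord0); [exact: memvf|rewrite addrC subrK].
suff WE : W = fullv.
  by exists (x - v); [rewrite /= WE memvf|rewrite addrC subrK].
apply/eqP; rewrite eqEsubv subvf /=; apply/subvP => z _; apply: contraT.
move=> /dot_separates[c cW]; suff -> : c = 0 by rewrite dot0l eqxx.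
apply/rowP => k; rewrite [RHS]mxE.
have Lc (i : 'I_10) : dot c (point i) = dot c v.
  have [w Ww <-] : flat v W (point i) by apply: PF; apply: sub_conv_hull; exists i.
  by rewrite dotDr (cW w Ww) addr0.
have := ys_ok (val k); rewrite mem_iota ltn_ord => /(_ isT).
set y := nth [::] ys k => /and3P[/eqP sy yk /allP y0].
have colE j : idot y (column j) = \sum_(i < 10) nth 0 y i * nth 0 (homog i) j.
  rewrite (@idotE 10) // ?size_map ?size_iota //.
  by apply: eq_bigr => i _; rewrite (nth_map 0%N) ?size_iota // nth_iota.
have sumy : \sum_(i < 10) nth 0 y i = 0.
  have := y0 5; rewrite mem_iota => /(_ isT); rewrite gtn_eqF ?ltn_ord //=.
  rewrite colE => /eqP sum0; rewrite -[RHS]sum0; apply: eq_bigr => i _.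
  by rewrite homog_last mulr1.
have : \sum_(i < 10) (nth 0 y i)%:~R * dot c (point i) = 0.
  under eq_bigr => i _ do rewrite Lc.
  by rewrite -mulr_suml -rmorph_sum /= sumy mul0r.
under eq_bigr => i _ do rewrite /dot mulr_sumr.
rewrite exchange_big /= (bigD1 k) //= [X in _ + X]big1 ?addr0 => [|j jk].
  move=> sumk; have : c 0 k * (idot y (column k))%:~R = 0 :> R.
    rewrite colE rmorph_sum mulr_sumr -[RHS]sumk; apply: eq_bigr => i _.
    by rewrite rmorphM /= homog_coord mulrCA.
  by move/eqP; rewrite mulf_eq0 intr_eq0 (negPf yk) orbF => /eqP.
have := y0 (val j); rewrite mem_iota /= add0n (leqW (ltn_ord j)) => /(_ isT).
case/orP => [/eqP/val_inj eq_jk|]; first by rewrite eq_jk eqxx in jk.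
rewrite colE => /eqP sum0.
have := congr1 (fun z => c 0 j * z%:~R : R) sum0; rewrite mulr0 => {}sum0; rewrite -[RHS]sum0.
rewrite rmorph_sum mulr_sumr; apply: eq_bigr => i _.
by rewrite rmorphM /= homog_coord mulrCA.
Qed.
End Points.
End Certificates.

(** * Two inequivalent polytopes with the same graph *)

Lemma card_ord_count n (f : pred nat) :
  #|[set i : 'I_n | f i]%SET| = count f (iota 0 n).
Proof.
by rewrite -sum1dep_card -(big_mkord f (fun=> 1%N)) sum1_count /index_iota subn0.
Qed.

Definition example_edges : seq (nat * nat) :=
  [:: (0, 1); (0, 2); (0, 3); (0, 4); (0, 5); (0, 7); (0, 8); (0, 9);
      (1, 2); (1, 3); (1, 4); (1, 5); (1, 6); (1, 8); (1, 9);
      (2, 3); (2, 4); (2, 5); (2, 6); (2, 7); (2, 9);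
      (3, 4); (3, 5); (3, 6); (3, 7); (3, 8);
      (4, 9); (5, 6); (6, 7); (7, 8); (8, 9)]%N.

Definition example_adj (i j : nat) : bool :=
  ((i, j) \in example_edges) || ((j, i) \in example_edges).

Definition example_graph : rel 'I_10 := fun i j => example_adj i j.

Definition example_cert pts fs ys spans : bool :=
  [&& well_sized pts, span_cert pts spans,
      all (fun i => face_cert pts fs [:: i]) (iota 0 10) &
      all (fun i => all (fun j => if example_adj i j
        then (i != j) && face_cert pts fs [:: i; j]
        else (i == j) || has (nonface_cert pts [:: i; j]) ys) (iota 0 10))
        (iota 0 10)].

(** The points [0] to [3] span a tetrahedron; [4] and [5] are the apexes of a
    bipyramid over it, which is the facet where the last coordinate vanishes; and
    [6] to [9] are the inner vertices of a path of simple vertices from [5] to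
    [4], each of them missing the edge to one vertex of the tetrahedron. *)
Definition points1 : seq (seq int) :=
  [:: [:: 4; 0; 0; 0; 0]; [:: 0; 4; 0; 0; 0]; [:: 0; 0; 4; 0; 0];
      [:: 0; 0; 0; 0; 0]; [:: 1; 1; 1; 2; 0]; [:: 1; 1; 1; -2; 0];
      [:: 0; 1; 2; -3; 1]; [:: 2; 0; 2; -2; 2]; [:: 4; 2; 0; 2; 2];
      [:: 3; 2; 1; 3; 1]].

Definition facets1 : seq (seq int) :=
  [:: [:: 0; 0; 0; 0; 1; 0]; [:: -2; -2; -2; -1; 7; 8];
      [:: -2; -2; -2; 1; 1; 8]; [:: 0; 0; 2; -1; 1; 0];
      [:: 0; 0; 2; 1; -1; 0]; [:: 0; 2; 0; -1; -1; 0];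
      [:: 0; 2; 0; 1; 1; 0]; [:: 2; 0; 0; -1; -3; 0];
      [:: 2; 0; 0; 1; 3; 0]].

Definition dependencies1 : seq (seq int) :=
  [:: [:: -1; 0; 0; 0; 0; 2; -2; 1; 0; 0]; [:: 0; -1; 0; 0; 0; 0; 2; -2; 1; 0];
      [:: 0; 0; -1; 0; 0; 0; 0; 1; -2; 2]; [:: 0; 0; 0; -1; 2; 0; 0; 0; 1; -2];
      [:: 1; 1; 1; 1; -2; -2; 0; 0; 0; 0]; [:: 0; 1; 1; 1; -2; 0; -2; 1; 0; 0];
      [:: 0; 0; 1; 1; -2; 0; 0; -1; 1; 0]; [:: 0; 0; 0; 1; -2; 0; 0; 0; -1; 2];
      [:: 1; 0; 0; 0; 0; -2; 2; -1; 0; 0]; [:: 2; 1; 0; 0; 0; -4; 2; 0; -1; 0];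
      [:: 3; 2; 1; 0; 0; -6; 2; 0; 0; -2]; [:: 0; 1; 0; 0; 0; 0; -2; 2; -1; 0];
      [:: 0; 2; 1; 0; 0; 0; -4; 3; 0; -2]; [:: 0; 0; 1; 0; 0; 0; 0; -1; 2; -2]].

Definition spans1 : seq (seq int) :=
  [:: [:: 1; 0; 0; -1; 0; 0; 0; 0; 0; 0]; [:: 0; 1; 0; -1; 0; 0; 0; 0; 0; 0];
      [:: 0; 0; 1; -1; 0; 0; 0; 0; 0; 0]; [:: 0; 0; 0; 0; 1; -1; 0; 0; 0; 0];
      [:: 0; -1; -2; -1; 3; -3; 4; 0; 0; 0]].

(** The first polytope scaled by two, with the apexes [4] and [5] moved to the
    midpoints of the edges to [9] and [6].  They have left the hyperplane of the
    bipyramid, which is now broken into two simplices along the tetrahedron. *)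
Definition points2 : seq (seq int) :=
  [:: [:: 8; 0; 0; 0; 0]; [:: 0; 8; 0; 0; 0]; [:: 0; 0; 8; 0; 0];
      [:: 0; 0; 0; 0; 0]; [:: 4; 3; 2; 5; 1]; [:: 1; 2; 3; -5; 1];
      [:: 0; 2; 4; -6; 2]; [:: 4; 0; 4; -4; 4]; [:: 8; 4; 0; 4; 4];
      [:: 6; 4; 2; 6; 2]].

Definition facets2 : seq (seq int) :=
  [:: [:: 0; 0; 0; -1; 5; 0]; [:: 0; 0; 0; 1; 5; 0];
      [:: -2; -2; -2; -1; 7; 16]; [:: -2; -2; -2; 1; 1; 16];
      [:: 0; 0; 2; -1; 1; 0]; [:: 0; 0; 2; 1; -1; 0];
      [:: 0; 2; 0; -1; -1; 0]; [:: 0; 2; 0; 1; 1; 0];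
      [:: 2; 0; 0; -1; -3; 0]; [:: 2; 0; 0; 1; 3; 0]].

Definition dependencies2 : seq (seq int) :=
  [:: [:: -1; 0; 0; 0; 0; 4; -4; 1; 0; 0]; [:: 0; -1; 0; 0; 0; 0; 2; -2; 1; 0];
      [:: 0; 0; -1; 0; 0; 0; 0; 1; -2; 2]; [:: 0; 0; 0; -1; 4; 0; 0; 0; 1; -4];
      [:: 4; 3; 2; 1; -4; -16; 10; 0; 0; 0]; [:: 0; 3; 2; 1; -4; 0; -6; 4; 0; 0];
      [:: 0; 0; 2; 1; -4; 0; 0; -2; 3; 0]; [:: 0; 0; 0; 1; -4; 0; 0; 0; -1; 4];
      [:: 1; 0; 0; 0; 0; -4; 4; -1; 0; 0]; [:: 2; 1; 0; 0; 0; -8; 6; 0; -1; 0];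
      [:: 3; 2; 1; 0; 0; -12; 8; 0; 0; -2]; [:: 0; 1; 0; 0; 0; 0; -2; 2; -1; 0];
      [:: 0; 2; 1; 0; 0; 0; -4; 3; 0; -2]; [:: 0; 0; 1; 0; 0; 0; 0; -1; 2; -2]].

Definition spans2 : seq (seq int) :=
  [:: [:: 1; 0; 0; -1; 0; 0; 0; 0; 0; 0]; [:: 0; 1; 0; -1; 0; 0; 0; 0; 0; 0];
      [:: 0; 0; 1; -1; 0; 0; 0; 0; 0; 0]; [:: -3; -1; 1; 3; 8; -8; 0; 0; 0; 0];
      [:: -9; -13; -17; -1; 24; -24; 40; 0; 0; 0]].

Lemma example_cert1 : example_cert points1 facets1 dependencies1 spans1.
Proof. by vm_compute. Qed.

Lemma example_cert2 : example_cert points2 facets2 dependencies2 spans2.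
Proof. by vm_compute. Qed.

Lemma example_nonsimple :
  (~: simple_set 5 example_graph)%SET = [set i : 'I_10 | val i \in iota 0 4]%SET.
Proof.
apply/finset.setP => i; rewrite finset.in_setC /simple_set !finset.in_set.
have -> : #|nbr example_graph i| = count (example_adj i) (iota 0 10).
  exact: card_ord_count.
have : all (fun i => (count (example_adj i) (iota 0 10) != 5%N) == (i \in iota 0 4))
    (iota 0 10) by vm_compute.
by move/allP => /(_ (val i)); rewrite mem_iota ltn_ord => /(_ isT)/eqP.
Qed.

Section Example.
Context {R : realType} {pts fs ys spans : seq (seq int)}.
Hypothesis cert : example_cert pts fs ys spans.

Local Notation pos := (@point pts R).
Local Notation P := (conv_hull (range pos)).

Lemma example_face1 i : is_face (affine_values pos) [set i]%SET.
Proof.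
case/and4P: cert => sz _ /allP/(_ (val i)) + _.
rewrite mem_iota ltn_ord => /(_ isT)/(face_certP (R := R) sz).
by congr is_face; apply/finset.setP => j; rewrite !inE.
Qed.

Lemma example_polytope : d_polytope 5 P.
Proof.
split; first exact: polytope_conv_range.
by case/and4P: cert => sz sp _ _; apply: span_certP sp.
Qed.

Lemma example_inj : injective pos.
Proof. exact: generators_inj example_face1. Qed.

Lemma example_range : vertices P = range pos.
Proof. exact: generators_vertices example_face1. Qed.

Lemma example_adjacent i j : example_graph i j <-> adjacent P (pos i) (pos j).
Proof.
have -> := adjacent_iff (polytope_conv_range pos) example_inj example_range i j.
have setE : [set i; j]%SET = [set k : 'I_10 | val k \in [:: val i; val j]]%SET.
  by apply/finset.setP => k; rewrite !inE.
case/and4P: cert => sz _ _ /allP/(_ (val i)).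
rewrite mem_iota ltn_ord => /(_ isT)/allP/(_ (val j)).
rewrite mem_iota ltn_ord => /(_ isT); rewrite /example_graph setE.
case: ifP => [_ /andP[ij face_ij]|_ /orP[/eqP/val_inj->|/hasP[y _ y_ij]]].
- have F := face_certP (R := R) sz face_ij.
  by split=> [_|_]; [split; [exact: ij|exact: F]|].
- by split=> [|[]]; [|rewrite eqxx].
have nF := nonface_certP (R := R) sz y_ij.
by split=> [|[_ F]]; [|case: (nF F)].
Qed.

Lemma example_card_vertices : vertices P #= `I_10.
Proof.
have -> : vertices P = pos @` [set` [set: 'I_10]%SET].
  by rewrite example_range; apply/seteqP; split=> _ [i _ <-]; exists i => //=; rewrite inE.
by apply/(card_pos example_inj); rewrite cardsT card_ord.
Qed.

Lemma example_card_nonsimple : nonsimple_vertices 5 P #= `I_4.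
Proof.
apply/(card_nonsimple_vertices example_inj example_range 5 4 example_adjacent).
by rewrite example_nonsimple (card_ord_count _ (mem (iota 0 4))).
Qed.
End Example.

Theorem inequivalent_same_graph (R : realType) :
  exists Q1 Q2 : set 'rV[R]_5,
     [/\ d_polytope 5 Q1 /\ d_polytope 5 Q2,
         vertices Q1 #= `I_10 /\ vertices Q2 #= `I_10,
         nonsimple_vertices 5 Q1 #= `I_4 /\ nonsimple_vertices 5 Q2 #= `I_4,
         same_graph Q1 Q2 &
         ~ comb_equivalent Q1 Q2].
Proof.
exists (conv_hull (range (@point points1 R))), (conv_hull (range (@point points2 R))).
have C1 := example_cert1; have C2 := example_cert2.
have pol1 := polytope_conv_range (@point points1 R).
have pol2 := polytope_conv_range (@point points2 R).
split.
- by split; [exact: example_polytope C1|exact: example_polytope C2].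
- by split; [exact: example_card_vertices C1|exact: example_card_vertices C2].
- by split; [exact: example_card_nonsimple C1|exact: example_card_nonsimple C2].
- exact: same_graph_indexed (example_inj C1) (example_inj C2)
    (example_range C1) (example_range C2) (example_adjacent C1) (example_adjacent C2).
have [sz1 _ _ _] := and4P C1; have [sz2 _ _ _] := and4P C2.
move/(comb_equivalent_nonsimple pol1 pol2 (example_inj C1) (example_inj C2)
  (example_range C1) (example_range C2) (example_adjacent C1) (example_adjacent C2) 5).
rewrite example_nonsimple => -[_ H].
(* The segment between the two apexes crosses the tetrahedron. *)
have /(_ [:: -1; -1; -1; -1; 2; 2; 0; 0; 0; 0])/(_ isT) :=
  @nonface_certP points1 R sz1 (iota 0 4).
by apply; apply/H/(face_certP (R := R) sz2 (fs := facets2)); vm_compute.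
Qed.

Theorem theorem12 (R : realType) :
  (forall (k d n s : nat) (P : set 'rV[R]_n),
     (5 <= k)%N ->
     d_polytope d P ->
     vertices P #= `I_(d + k)%N ->
     nonsimple_vertices d P #= `I_s ->
     (s + k <= d + 3)%N ->
     reconstructible d P) /\
  (exists Q1 Q2 : set 'rV[R]_5,
     [/\ d_polytope 5 Q1 /\ d_polytope 5 Q2,
         vertices Q1 #= `I_10 /\ vertices Q2 #= `I_10,
         nonsimple_vertices 5 Q1 #= `I_4 /\ nonsimple_vertices 5 Q2 #= `I_4,
         same_graph Q1 Q2 &
         ~ comb_equivalent Q1 Q2]).
Proof.
split; last exact: inequivalent_same_graph.
by move=> k d n s P; apply: reconstructible_few_nonsimple.
Qed.
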